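(* (a) If $A\in M_2(\mathbb R)$ is not normal, then $\mathcal M_{\mathbb R}(\exp A)<\|A\|_2$. (b) If $A\in M_2(\mathbb C)$ is not normal, then $\mathcal M_{\mathbb C}(\exp A)<\|A\|_2$.
   Context: $\|\cdot\|_2$ is the operator norm. For $\mathbb F\in\{\mathbb R,\mathbb C\}$ and $A\in M_n(\mathbb F)$, the Magnus exponent is $\mathcal M_{\mathbb F}(A)=\inf\{\sum_{i=1}^k\|B_i\|_2 : k\ge1,\ B_1,\dots,B_k\in M_n(\mathbb F),\ \exp(B_k)\cdots\exp(B_1)=A\}$ (with $\inf\emptyset=+\infty$); equivalently, the infimum of $\int\|\phi(\theta)\|_2\,\mathrm d\theta$ over integrable $M_n(\mathbb F)$-valued densities $\phi$ whose time-ordered exponential (the value at the endpoint of the solution of $Z'=\phi Z$, $Z(\text{start})=\mathrm{Id}$) equals $A$. *)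

(* Defs.v *)
From HB Require Import structures.
From mathcomp Require Import all_boot all_order all_algebra.
From mathcomp Require Import all_classical all_reals all_analysis.
From mathcomp.real_closed Require Import complex.

Set Implicit Arguments.
Unset Strict Implicit.
Unset Printing Implicit Defensive.

Import Order.TTheory GRing.Theory Num.Theory.
Import numFieldNormedType.Exports.

Local Open Scope classical_set_scope.
Local Open Scope ring_scope.

Section Generic.
(* K is the scalar field (R or C), viewed as a normed field; [absR] gives the
   absolute value of a scalar as a real number in R. *)
Variables (R : realType) (K : numFieldType) (absR : K -> R).

Definition mexp (n : nat) (B : 'M[K]_n) : 'M[K]_n :=
  lim ((fun N : nat => \sum_(k < N) ((k`!)%:R)^-1 *: B ^+ k) @ \oo).

Definition vnorm2 (n : nat) (v : 'cV[K]_n) : R :=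
  Num.sqrt (\sum_i absR (v i 0) ^+ 2).

Definition opnorm2 (n : nat) (B : 'M[K]_n) : R :=
  sup [set vnorm2 (B *m v) | v in [set v : 'cV[K]_n | vnorm2 v = 1]].

(* Magnus exponent: infimum of sum ||B_i||_2 over k >= 1 and B_1..B_k with
   exp(B_k) ... exp(B_1) = A  (inf of the empty set is +oo). The list
   [Bs = [:: B_1; ...; B_k]]. *)
Definition magnus (n : nat) (A : 'M[K]_n) : \bar R :=
  ereal_inf [set ((\sum_(B <- Bs) opnorm2 B)%:E)%E
            | Bs in [set Bs : seq 'M[K]_n |
                     Bs != [::] /\ \prod_(B <- rev Bs) mexp B = A]].
End Generic.

Definition absRe (R : realType) (x : R) : R := `|x|.
Definition absCx (R : realType) (z : R[i]) : R :=
  Num.sqrt (complex.Re z ^+ 2 + complex.Im z ^+ 2).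

Definition normal_real (R : realType) (n : nat) (A : 'M[R]_n) : Prop :=
  A *m A^T = A^T *m A.
Definition normal_cx (R : realType) (n : nat) (A : 'M[R[i]]_n) : Prop :=
  let Astar := (map_mx (@conjc R) A)^T in A *m Astar = Astar *m A.

(* Main.v *)
(* If A is not normal, the constant path t |-> exp (t A) is not a critical point
   of the length, so a first-order variation shortens it. After a unitary
   conjugation the columns of A are orthogonal and the first one is strictly the
   longer: A attains its norm sigma only at e0, and the norm is differentiable
   at A with derivative H |-> <A e0, H e0> / sigma. With X = e0 e0^* this
   derivative takes the value - |<e1, A e0>|^2 / sigma at [X, A], and
   <e1, A e0> <> 0 precisely because A is not normal. Take P = exp (d^2 X) and
   write, for small d > 0,
     exp A = (exp (d A) P^-1) (P exp ((1 - 2 d) A) P^-1) (P exp (d A)).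
   The middle factor is exp ((1 - 2 d) P A P^-1), which is shorter by a multiple
   of d^2. Each outer factor is a single exponential exp (d A -+ d^2 X) up to a
   factor whose logarithm is O(d^3), because exp (S + T) - exp S exp T is
   O(|S| |T|); the first-order changes of the two outer norms cancel and what is
   left is O(d^3). *)

Require Import Defs.
From HB Require Import structures.
From mathcomp Require Import all_boot all_order all_algebra.
From mathcomp Require Import all_classical all_reals all_analysis.
From mathcomp.real_closed Require Import complex.
From mathcomp Require Import ring lra.

Import Order.TTheory GRing.Theory Num.Theory.
Import numFieldNormedType.Exports.
Local Open Scope ring_scope.

Set Implicit Arguments.
Unset Strict Implicit.
Unset Printing Implicit Defensive.

(** * Partial sums of the exponential series and elementary estimates *)

(** Defined in any algebra, so that one identity serves both the matrix series and, over [R^o], the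
    real series of norms that dominates it. *)
Definition expsum (F : numFieldType) (V : algType F) (x : V) (N : nat) : V :=
  \sum_(k < N) (k`!%:R)^-1 *: x ^+ k.

(** The square of indices is cut along its antidiagonals: those with [k + j < N] are complete and
    form the Cauchy product, the rest is the corner [k + j >= N]. *)
Lemma sum_square (V : zmodType) (G : nat -> nat -> V) N :
  \sum_(k < N) \sum_(j < N) G k j = \sum_(m < N) \sum_(i < m.+1) G (m - i)%N i
    + \sum_(0 <= k < N) \sum_(N - k <= j < N) G k j.
Proof.
have tri M : \sum_(m < M) \sum_(i < m.+1) G (m - i)%N i =
    \sum_(0 <= k < M) \sum_(0 <= j < M - k) G k j.
  elim: M => [|M IH]; first by rewrite big_ord0 big_geq.
  rewrite big_ord_recr/= IH big_nat_recr//= subSnn big_nat1.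
  have -> : \sum_(0 <= k < M) \sum_(0 <= j < M.+1 - k) G k j =
      \sum_(0 <= k < M) (\sum_(0 <= j < M - k) G k j + G k (M - k)%N).
    by apply: eq_big_nat => k /andP[_ kM]; rewrite subSn 1?ltnW// big_nat_recr.
  rewrite big_split/= -addrA; congr (_ + _).
  rewrite (reindex_inj rev_ord_inj)/= big_ord_recr/= subSS subnn; congr (_ + _).
    rewrite big_mkord; apply: eq_bigr => i _.
    by rewrite subSS subKn// ltnW.
  by rewrite subn0.
rewrite tri -big_split/= big_mkord; apply: eq_bigr => k _.
by rewrite -(big_mkord xpredT) -big_cat_nat// leq_subr.
Qed.

(** By the binomial formula the complete antidiagonals add up to [expsum (x + y) N], so only the
    corner is left. Its coefficients are positive, so the defect for matrices is bounded by the
    defect for their norms. *)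
Lemma expsumD (F : numFieldType) (V : algType F) (x y : V) N :
  GRing.comm x y ->
  expsum x N * expsum y N - expsum (x + y) N =
  \sum_(0 <= k < N) \sum_(N - k <= j < N)
    ((k`!%:R)^-1 * (j`!%:R)^-1) *: (x ^+ k * y ^+ j).
Proof.
move=> xy; apply/eqP; rewrite subr_eq addrC; apply/eqP.
rewrite /expsum mulr_suml; under eq_bigr do rewrite mulr_sumr.
under eq_bigr do under eq_bigr do rewrite -scalerAl -scalerAr scalerA.
rewrite (sum_square (fun k j => ((k`!%:R)^-1 * (j`!%:R)^-1) *: (x ^+ k * y ^+ j))).
congr (_ + _); apply: eq_bigr => m _.
rewrite exprDn_comm// scaler_sumr; apply: eq_bigr => i _.
have im : (i <= m)%N by rewrite -ltnS.
rewrite -[_ *+ 'C(m, i)]scaler_nat scalerA; congr (_ *: _).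
rewrite -(bin_fact im) !natrM.
have h k : k`!%:R != 0 :> F by rewrite pnatr_eq0 -lt0n fact_gt0.
have b0 : 'C(m, i)%:R != 0 :> F by rewrite pnatr_eq0 -lt0n bin_gt0.
by field; rewrite b0 !h.
Qed.

(** All three follow from [expR a * (1 - a) <= 1], that is, [1 - a <= expR (- a)]. *)
Lemma expR_bounds (R : realType) (a : R) : 0 <= a -> a <= 2^-1 ->
  [/\ expR a <= 2, expR a - 1 <= 2 * a & expR a - 1 - a <= 2 * a ^+ 2].
Proof.
move=> a0 a1; have h : expR a * (1 - a) <= 1.
  rewrite -[leRHS](mulfV (lt0r_neq0 (expR_gt0 a))) -expRN ler_wpM2l ?expR_ge0//.
  exact: expR_ge1Dx.
have := expR_gt0 a; move: (expR a) h => E h E0.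
by split; nra.
Qed.

Lemma sum_ord2 (V : nmodType) (f : 'I_2 -> V) : \sum_i f i = f 0 + f 1.
Proof.
by rewrite big_ord_recl big_ord1; congr (_ + f _); exact: val_inj.
Qed.

(** * Scalars and matrix norm *)

(* A common abstraction of the two scalar fields; [inj] embeds the reals and
   [cj] is the conjugation (the identity when [K = R]). *)
Record scalar_field (R : realType) (K : numFieldType) (absR : K -> R) :=
  ScalarField {
  inj : {rmorphism R -> K};
  cj : {rmorphism K -> K};
  re : K -> R;
  normE : forall x, `|x| = inj (absR x);
  inj_ge0 : forall r, 0 <= r -> 0 <= inj r;
  inj_surj_pos : forall e : K, 0 < e -> exists2 r, 0 < r & e = inj r;
  cjM : forall x, cj x * x = inj (absR x ^+ 2);
  cjK : involutive cj;
  cj_inj : forall r, cj (inj r) = inj r;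
  reE : forall x, x + cj x = inj (re x *+ 2);
  scalar_complete : forall (u : nat -> K) (v : nat -> R),
    (forall n, absR (u n.+1 - u n) <= v n.+1 - v n) -> cvgn v ->
    exists l, ((fun n => absR (u n - l)) @ \oo --> (0 : R))%classic
}.

Lemma cvg_sum0 (R : realType) (I : finType) (f : I -> nat -> R) :
  (forall i, (f i @ \oo --> (0 : R))%classic) ->
  ((fun k => \sum_i f i k) @ \oo --> (0 : R))%classic.
Proof.
move=> h; elim: (index_enum I) => [|i s IH].
  by under eq_fun do rewrite big_nil; exact: cvg_cst.
under eq_fun do rewrite big_cons.
have := cvgD (h i) IH; rewrite addr0; exact.
Qed.

Section Generic.
Variables (R : realType) (K : numFieldType) (absR : K -> R).
Variable F : scalar_field absR.
Local Notation inj := (inj F).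
Local Notation cj := (cj F).
Local Notation re := (re F).

Lemma ler_inj a b : (inj a <= inj b) = (a <= b).
Proof.
case: (leP a b) => [ab|ba].
  by rewrite -subr_ge0 -rmorphB inj_ge0// subr_ge0.
apply: lt_geF; rewrite lt_def (inj_eq (fmorph_inj _)) gt_eqF//=.
by rewrite -subr_ge0 -rmorphB inj_ge0// subr_ge0 ltW.
Qed.

Lemma ltr_inj a b : (inj a < inj b) = (a < b).
Proof. by rewrite !lt_def (inj_eq (fmorph_inj _)) ler_inj. Qed.

Lemma absR_ge0 x : 0 <= absR x.
Proof. by rewrite -ler_inj rmorph0 -normE. Qed.

Lemma absR0 : absR 0 = 0.
Proof. by apply: (fmorph_inj inj); rewrite -normE normr0 rmorph0. Qed.

Lemma absR1 : absR 1 = 1.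
Proof. by apply: (fmorph_inj inj); rewrite -normE normr1 rmorph1. Qed.

Lemma absR_eq0 x : absR x = 0 -> x = 0.
Proof. by move=> h; apply/eqP; rewrite -normr_eq0 (normE F) h rmorph0. Qed.

Lemma absRD x y : absR (x + y) <= absR x + absR y.
Proof. by rewrite -ler_inj rmorphD -!normE ler_normD. Qed.

Lemma absRN x : absR (- x) = absR x.
Proof. by apply: (fmorph_inj inj); rewrite -!normE normrN. Qed.

Lemma absRM x y : absR (x * y) = absR x * absR y.
Proof. by apply: (fmorph_inj inj); rewrite rmorphM -!normE normrM. Qed.

Lemma absR_inj r : 0 <= r -> absR (inj r) = r.
Proof.
by move=> r0; apply: (fmorph_inj inj); rewrite -!normE ger0_norm// inj_ge0.
Qed.

Lemma absR_sum (I : Type) (s : seq I) (P : pred I) (G : I -> K) :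
  absR (\sum_(i <- s | P i) G i) <= \sum_(i <- s | P i) absR (G i).
Proof.
elim/big_ind2 : _ => [|x1 x2 y1 y2 h1 h2|//]; first by rewrite absR0.
by rewrite (le_trans (absRD _ _))// lerD.
Qed.

Lemma absR_cj x : absR (cj x) = absR x.
Proof.
apply/eqP; rewrite -(@eqrXn2 _ 2)// ?absR_ge0//; apply/eqP.
by apply: (fmorph_inj inj); rewrite -!cjM cjK mulrC.
Qed.

(** * The maximal row sum norm *)

Section MatrixNorm.
Variable n : nat.
Implicit Types M N : 'M[K]_n.+1.

(** The operator norm induced by the sup norm. Being submultiplicative and computable from the
    entries, it carries all error estimates; [opnorm_le_nrm] and [opnorm_perturb] translate them to
    [opnorm2]. *)
Definition nrm M : R :=
  \big[Order.max/0]_i \sum_j absR (M i j).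

Lemma row_le_nrm M i : \sum_j absR (M i j) <= nrm M.
Proof. exact: (le_bigmax _ (fun i => \sum_j absR (M i j))). Qed.

Lemma nrm_le M c : 0 <= c -> (forall i, \sum_j absR (M i j) <= c) -> nrm M <= c.
Proof. by move=> c0 h; apply: bigmax_le => // i _; exact: h. Qed.

Lemma nrm_ge0 M : 0 <= nrm M.
Proof.
apply: le_trans (row_le_nrm M 0).
by apply: sumr_ge0 => j _; exact: absR_ge0.
Qed.

Lemma entry_le_nrm M i j : absR (M i j) <= nrm M.
Proof.
apply: le_trans (row_le_nrm M i); rewrite (bigD1 j)//= lerDl.
by apply: sumr_ge0 => k _; exact: absR_ge0.
Qed.

Lemma nrm_eq0 M : nrm M = 0 -> M = 0.
Proof.
move=> h; apply/matrixP => i j; rewrite mxE; apply: absR_eq0; apply/eqP.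
by rewrite eq_le absR_ge0 andbT -h entry_le_nrm.
Qed.

Lemma nrm0 : nrm 0 = 0.
Proof.
apply/eqP; rewrite eq_le nrm_ge0 andbT nrm_le// => i.
by rewrite big1// => j _; rewrite mxE absR0.
Qed.

Lemma nrm1 : nrm 1 = 1.
Proof.
have row1 i : \sum_j absR ((1 : 'M[K]_n.+1) i j) = 1.
  rewrite (bigD1 i)//= mxE eqxx absR1 big1 ?addr0// => j ji.
  by rewrite mxE eq_sym (negbTE ji) absR0.
apply/eqP; rewrite eq_le -{2}(row1 0) row_le_nrm andbT.
by rewrite nrm_le// => i; rewrite row1.
Qed.

Lemma nrmN M : nrm (- M) = nrm M.
Proof.
by apply: eq_bigr => i _; apply: eq_bigr => j _; rewrite mxE absRN.
Qed.

Lemma nrmD M N : nrm (M + N) <= nrm M + nrm N.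
Proof.
apply: nrm_le => [|i]; first by rewrite addr_ge0 ?nrm_ge0.
apply: le_trans (lerD (row_le_nrm M i) (row_le_nrm N i)).
by rewrite -big_split ler_sum// => j _; rewrite mxE absRD.
Qed.

Lemma nrmB M N : nrm (M - N) <= nrm M + nrm N.
Proof. by rewrite -(nrmN N) nrmD. Qed.

Lemma nrm_dist M N : nrm (M - N) = nrm (N - M).
Proof. by rewrite -nrmN opprB. Qed.

Lemma nrm_split N M P : nrm (M - P) <= nrm (M - N) + nrm (N - P).
Proof. by apply: le_trans (nrmD _ _); rewrite addrA subrK. Qed.

Lemma nrm_sum (I : Type) (s : seq I) (P : pred I) (G : I -> 'M[K]_n.+1) :
  nrm (\sum_(i <- s | P i) G i) <= \sum_(i <- s | P i) nrm (G i).
Proof.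
elim/big_ind2 : _ => [|x1 x2 y1 y2 h1 h2|//]; first by rewrite nrm0.
by rewrite (le_trans (nrmD _ _))// lerD.
Qed.

Lemma nrmM M N : nrm (M * N) <= nrm M * nrm N.
Proof.
apply: nrm_le => [|i]; first by rewrite mulr_ge0 ?nrm_ge0.
apply: (@le_trans _ _ (\sum_j \sum_k absR (M i k) * absR (N k j))).
  apply: ler_sum => j _; rewrite mxE; apply: le_trans (absR_sum _ _ _) _.
  by apply: ler_sum => k _; rewrite absRM.
rewrite exchange_big/=; under eq_bigr do rewrite -mulr_sumr.
apply: (@le_trans _ _ (\sum_k absR (M i k) * nrm N)).
  by apply: ler_sum => k _; rewrite ler_wpM2l ?absR_ge0// row_le_nrm.
by rewrite -mulr_suml ler_wpM2r ?nrm_ge0// row_le_nrm.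
Qed.

Lemma nrmZ (c : K) M : nrm (c *: M) <= absR c * nrm M.
Proof.
apply: nrm_le => [|i]; first by rewrite mulr_ge0 ?nrm_ge0 ?absR_ge0.
apply: le_trans (ler_wpM2l (absR_ge0 c) (row_le_nrm M i)).
by rewrite mulr_sumr ler_sum// => j _; rewrite mxE absRM.
Qed.

Lemma nrmZ_inj r M : 0 <= r -> nrm (inj r *: M) <= r * nrm M.
Proof. by move=> r0; rewrite -{2}(absR_inj r0) nrmZ. Qed.

Lemma nrmX M k : nrm (M ^+ k) <= nrm M ^+ k.
Proof.
elim: k => [|k IH]; first by rewrite !expr0 nrm1.
rewrite !exprS; apply: le_trans (nrmM _ _) _.
by rewrite ler_wpM2l ?nrm_ge0.
Qed.

(** * Convergence and completeness in the row sum norm *)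

(** Phrased through a real sequence, so that real limit theory applies over either scalar field. *)
Definition ncvg (u : nat -> 'M[K]_n.+1) (L : 'M[K]_n.+1) :=
  ((fun k => nrm (u k - L)) @ \oo --> (0 : R))%classic.

Lemma ncvg_squeeze u L (w : nat -> R) :
  (forall k, nrm (u k - L) <= w k) -> (w @ \oo --> (0 : R))%classic ->
  ncvg u L.
Proof.
move=> h w0; apply: (squeeze_cvgr _ (@cvg_cst _ _ _ _ _) w0).
by apply: nearW => k; rewrite nrm_ge0 h.
Qed.

Lemma ncvg_cst L : ncvg (fun=> L) L.
Proof.
by apply: (@ncvg_squeeze _ _ (fun=> 0)) => [k|]; [rewrite subrr nrm0|exact: cvg_cst].
Qed.

Lemma ncvgD u v L M : ncvg u L -> ncvg v M -> ncvg (fun k => u k + v k) (L + M).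
Proof.
move=> hu hv; apply: (ncvg_squeeze (w := fun k => nrm (u k - L) + nrm (v k - M))).
  by move=> k; rewrite opprD addrACA nrmD.
by rewrite -[0 in X in (_ --> X)%classic]addr0; apply: cvgD.
Qed.

Lemma ncvgN u L : ncvg u L -> ncvg (fun k => - u k) (- L).
Proof.
move=> hu; apply: ncvg_squeeze hu => k.
by rewrite -opprD nrmN.
Qed.

Lemma ncvgB u v L M : ncvg u L -> ncvg v M -> ncvg (fun k => u k - v k) (L - M).
Proof. by move=> hu hv; apply: ncvgD => //; apply: ncvgN. Qed.

Lemma ncvgM u v L M : ncvg u L -> ncvg v M -> ncvg (fun k => u k * v k) (L * M).
Proof.
move=> hu hv; pose a k := nrm (u k - L); pose b k := nrm (v k - M).
apply: (ncvg_squeeze (w := fun k => a k * b k + a k * nrm M + nrm L * b k)).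
  move=> k; have -> : u k * v k - L * M =
      (u k - L) * (v k - M) + (u k - L) * M + L * (v k - M).
    by rewrite -mulrDr subrK mulrBl mulrBr addrA subrK.
  by rewrite (le_trans (nrmD _ _))// lerD ?nrmM// (le_trans (nrmD _ _))//
    lerD ?nrmM.
have -> : (0 : R) = 0 * 0 + 0 * nrm M + nrm L * 0.
  by rewrite !mul0r mulr0 !addr0.
apply: (cvgD (cvgD (cvgM hu hv) (cvgM hu (cvg_cst (nrm M)))) (cvgM (cvg_cst (nrm L)) hv)).
Qed.

Lemma ncvg_nrm_le u L (v : nat -> R) l : ncvg u L ->
  (forall k, nrm (u k) <= v k) -> (v @ \oo --> l)%classic -> nrm L <= l.
Proof.
move=> hu h hv.
have hw : ((fun k => v k + nrm (u k - L)) @ \oo --> l)%classic.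
  by rewrite -[l in X in (_ --> X)%classic]addr0; apply: cvgD.
rewrite -(cvg_lim _ hw)//; apply: limr_ge; first exact: cvgP hw.
apply: nearW => k; apply: le_trans (lerD (h k) (lexx _)).
by rewrite nrm_dist; apply: le_trans (nrmD _ _); rewrite addrC subrK.
Qed.

Lemma ncvg_unique u L M : ncvg u L -> ncvg u M -> L = M.
Proof.
move=> hL hM; apply/eqP; rewrite -subr_eq0; apply/eqP/nrm_eq0/eqP.
rewrite eq_le nrm_ge0 andbT.
have h := ncvgB hL hM.
apply: (ncvg_nrm_le h (v := fun=> 0)); last exact: cvg_cst.
by move=> k; rewrite subrr nrm0.
Qed.

Lemma ncvg_shift u L k : ncvg u L -> ncvg (fun i => u (i + k)%N) L.
Proof. by rewrite /ncvg -(cvg_shiftn k). Qed.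

(** The topology behind [lim] comes from the [K]-valued [mx_norm]. A nonzero [mx_norm] is the
    absolute value of some entry, hence at most [nrm]. *)
Lemma ncvg_lim u L : ncvg u L -> (lim (u @ \oo) = L)%classic.
Proof.
move=> hu; apply: cvg_lim; first exact: norm_hausdorff.
apply/cvgrPdist_lt => e /(inj_surj_pos F)[r r0 ->].
move/cvgrPdist_lt : hu => /(_ _ r0).
apply: filterS => k; rewrite sub0r normrN ger0_norm ?nrm_ge0// => h.
change (mx_norm (L - u k) < inj r).
have [->|/mx_norm_neq0[[i j] ->]] := eqVneq (mx_norm (L - u k)) 0.
  by rewrite -(rmorph0 inj) ltr_inj.
rewrite (normE F) ltr_inj; apply: le_lt_trans h.
by rewrite nrm_dist; apply: entry_le_nrm.
Qed.

Lemma nrm_telescope (u : nat -> 'M[K]_n.+1) (v : nat -> R) :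
  (forall k, nrm (u k.+1 - u k) <= v k.+1 - v k) ->
  forall k m, (k <= m)%N -> nrm (u m - u k) <= v m - v k.
Proof.
move=> h k m /subnKC <-; elim: (m - k)%N => [|i IH].
  by rewrite addn0 !subrr nrm0.
rewrite addnS; apply: le_trans (nrm_split (u (k + i)%N) _ _) _.
by apply: le_trans (lerD (h _) IH) _; rewrite addrA subrK.
Qed.

(** Every entry has its steps dominated by those of [v], so limits exist entrywise; letting [m] tend
    to infinity in [nrm (u m - u k) <= v m - v k] gives the rate. *)
Lemma nrm_complete (u : nat -> 'M[K]_n.+1) (v : nat -> R) l :
  (forall k, nrm (u k.+1 - u k) <= v k.+1 - v k) -> (v @ \oo --> l)%classic ->
  exists2 L, ncvg u L & forall k, nrm (L - u k) <= l - v k.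
Proof.
move=> h vl.
have /choice [L hL] : forall ij : 'I_n.+1 * 'I_n.+1,
    exists l, ((fun k => absR (u k ij.1 ij.2 - l)) @ \oo --> (0 : R))%classic.
  move=> [i j]; apply: (scalar_complete F (v := v)) => [k|].
    by apply: le_trans (h k); have := entry_le_nrm (u k.+1 - u k) i j; rewrite !mxE.
  by apply: cvgP vl.
pose M : 'M[K]_n.+1 := \matrix_(i, j) L (i, j).
have uM : ncvg u M.
  apply: (ncvg_squeeze (w := fun k => \sum_i \sum_j absR (u k i j - L (i, j)))).
    move=> k; apply: nrm_le => [|i].
      by do 2!apply: sumr_ge0 => ? _; exact: absR_ge0.
    rewrite [leRHS](bigD1 i)//= ler_wpDr//.
      by do 2!apply: sumr_ge0 => ? _; exact: absR_ge0.
    by apply: ler_sum => j _; rewrite !mxE.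
  by apply: cvg_sum0 => i; apply: cvg_sum0 => j; exact: (hL (i, j)).
exists M => // k.
have hs := ncvg_shift k (ncvgB uM (ncvg_cst (u k))).
apply: (ncvg_nrm_le hs (v := fun i => v (i + k)%N - v k)) => [i|].
  by apply: nrm_telescope => //; rewrite leq_addl.
by apply: cvgB; [rewrite (cvg_shiftn k)|apply: cvg_cst].
Qed.

End MatrixNorm.

(** * The exponential series *)

Section Exponential.
Variable n : nat.
Implicit Types A B M S T : 'M[K]_n.+1.
Local Notation expsumR x := (expsum (x : R^o)).

Lemma expsumR_cvg (x : R) : (expsumR x @ \oo --> expR x)%classic.
Proof.
have -> : expsumR x = series (exp_coeff x).
  apply/funext => N; rewrite seriesEord; apply: eq_bigr => k _.
  exact: mulrC.
exact: is_cvg_series_exp_coeff.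
Qed.

Lemma absR_invfact k : absR (k`!%:R)^-1 = (k`!%:R)^-1.
Proof. by rewrite -(rmorph_nat inj) -fmorphV absR_inj// invr_ge0. Qed.

Lemma nrm_invfactZ k M c : nrm M <= c -> nrm ((k`!%:R)^-1 *: M) <= (k`!%:R)^-1 * c.
Proof.
move=> h; apply: le_trans (nrmZ _ _) _.
by rewrite absR_invfact ler_wpM2l// invr_ge0.
Qed.

(** The steps of the matrix series are dominated by those of the real series at [nrm M]. The cases
    [N = 0, 1, 2] give the three bounds below. *)
Lemma mexp_tail M : ncvg (expsum M) (mexp M) /\
  forall N, nrm (mexp M - expsum M N) <= expR (nrm M) - expsumR (nrm M) N.
Proof.
have step k : nrm (expsum M k.+1 - expsum M k) <=
    expsumR (nrm M) k.+1 - expsumR (nrm M) k.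
  rewrite /expsum !big_ord_recr/= !(addrC (\sum_(_ < _) _)) !addrK.
  exact/nrm_invfactZ/nrmX.
have [L ML tail] := nrm_complete step (@expsumR_cvg (nrm M)).
by rewrite (_ : mexp M = L)//; apply: ncvg_lim.
Qed.

Lemma mexp_cvg M : ncvg (expsum M) (mexp M).
Proof. by have [] := mexp_tail M. Qed.

Lemma nrm_mexp M : nrm (mexp M) <= expR (nrm M).
Proof. by have [_ /(_ 0)] := mexp_tail M; rewrite /expsum !big_ord0 !subr0. Qed.

Lemma nrm_mexpB1 M : nrm (mexp M - 1) <= expR (nrm M) - 1.
Proof.
have [_ /(_ 1)] := mexp_tail M.
by rewrite /expsum !big_ord1 !expr0 fact0 !invr1 !scale1r.
Qed.

Lemma nrm_mexpB1B M : nrm (mexp M - 1 - M) <= expR (nrm M) - 1 - nrm M.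
Proof.
have [_ /(_ 2)] := mexp_tail M.
by rewrite /expsum !big_ord_recl !big_ord0 /= /bump/= !expr0 !expr1 !fact0 !invr1
  !scale1r !addr0 !opprD !addrA.
Qed.

Lemma mexp0 : mexp (0 : 'M[K]_n.+1) = 1.
Proof.
apply/eqP; rewrite -subr_eq0; apply/eqP/nrm_eq0/eqP.
rewrite eq_le nrm_ge0 andbT; apply: le_trans (nrm_mexpB1 _) _.
by rewrite nrm0 expR0 subrr.
Qed.

(** The defect of the partial sums is the corner of [expsumD]; in norm it is at most the
    corresponding real corner, which tends to [expR a * expR b - expR (a + b) = 0]. *)
Lemma mexpD A B : GRing.comm A B -> mexp (A + B) = mexp A * mexp B.
Proof.
move=> AB; apply/esym/eqP; rewrite -subr_eq0; apply/eqP.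
apply: ncvg_unique (ncvgB (ncvgM (mexp_cvg A) (mexp_cvg B)) (mexp_cvg (A + B))) _.
pose a : R^o := nrm A; pose b : R^o := nrm B.
apply: (ncvg_squeeze (w := fun N => expsum a N * expsum b N - expsum (a + b) N)).
  move=> N; rewrite subr0 !expsumD//; last exact: mulrC.
  apply: le_trans (nrm_sum _ _ _) _; apply: ler_sum => k _.
  apply: le_trans (nrm_sum _ _ _) _; apply: ler_sum => j _.
  rewrite -!scalerA; apply/nrm_invfactZ/nrm_invfactZ.
  by apply: le_trans (nrmM _ _) _; rewrite ler_pM ?nrm_ge0 ?nrmX.
rewrite -[0 in X in (_ --> X)%classic](subrr (expR (a + b))) {1}expRD.
apply: cvgB; last exact: expsumR_cvg.
by apply: cvgM; exact: expsumR_cvg.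
Qed.

Lemma mexpNK A : mexp (- A) * mexp A = 1.
Proof. by rewrite -mexpD ?addNr ?mexp0// /GRing.comm mulrN mulNr. Qed.

Lemma mexpKN A : mexp A * mexp (- A) = 1.
Proof. by have := mexpNK (- A); rewrite opprK. Qed.

Lemma comm_mexp A B : GRing.comm A B -> GRing.comm A (mexp B).
Proof.
move=> AB; apply: ncvg_unique (ncvgM (ncvg_cst A) (mexp_cvg B)) _.
have -> : (fun k => A * expsum B k) = (fun k => expsum B k * A).
  apply/funext => k; rewrite mulr_sumr mulr_suml; apply: eq_bigr => i _.
  by rewrite -scalerAr -scalerAl (commrX i AB).
exact: ncvgM (mexp_cvg B) (ncvg_cst A).
Qed.

Lemma mexp_conj P Q M : P * Q = 1 -> Q * P = 1 ->
  mexp (P * M * Q) = P * mexp M * Q.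
Proof.
move=> PQ QP; apply: ncvg_unique (mexp_cvg _) _.
have -> : expsum (P * M * Q) = (fun k => P * expsum M k * Q).
  apply/funext => k; rewrite mulr_sumr mulr_suml; apply: eq_bigr => i _.
  rewrite -scalerAr -scalerAl; congr (_ *: _); elim: {k i}(i : nat) => [|i IH].
    by rewrite !expr0 mulr1.
  by rewrite !exprS IH !mulrA -(mulrA (P * M) Q P) QP mulr1.
exact: ncvgM (ncvgM (ncvg_cst P) (mexp_cvg M)) (ncvg_cst Q).
Qed.

(** The difference is the sum of all words using both [S] and [T], each bounded by the same word in
    the norms. The induction splits off the first letter: a pure word becomes mixed only as
    [T * S ^+ k.+1] or [S * T ^+ k.+1]. *)
Lemma nrm_exprD_mixed S T k :
  nrm ((S + T) ^+ k.+1 - S ^+ k.+1 - T ^+ k.+1) <=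
  (nrm S + nrm T) ^+ k.+1 - nrm S ^+ k.+1 - nrm T ^+ k.+1.
Proof.
elim: k => [|k IH].
  by rewrite !expr1 (addrC S) addrK subrr nrm0 (addrC (nrm S)) addrK subrr.
set s := nrm S; set t := nrm T.
have -> : (S + T) ^+ k.+2 - S ^+ k.+2 - T ^+ k.+2 =
    (S + T) * ((S + T) ^+ k.+1 - S ^+ k.+1 - T ^+ k.+1) +
    (T * S ^+ k.+1 + S * T ^+ k.+1).
  rewrite !mulrBr -exprS !mulrDl -!exprS !opprD !addrA.
  by rewrite [RHS](ACl (1*2*5*(3*6)*(4*7)))/= !addNr !addr0.
have -> : (s + t) ^+ k.+2 - s ^+ k.+2 - t ^+ k.+2 =
    (s + t) * ((s + t) ^+ k.+1 - s ^+ k.+1 - t ^+ k.+1) +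
    (t * s ^+ k.+1 + s * t ^+ k.+1).
  by rewrite !(exprS _ k.+1); ring.
have step A B i : nrm (A * B ^+ i) <= nrm A * nrm B ^+ i.
  by apply: le_trans (nrmM _ _) _; rewrite ler_wpM2l ?nrm_ge0 ?nrmX.
apply: le_trans (nrmD _ _) _; apply: lerD.
  by apply: le_trans (nrmM _ _) _; rewrite ler_pM ?nrm_ge0 ?nrmD.
by apply: le_trans (nrmD _ _) _; rewrite lerD.
Qed.

(* Only words mixing [S] and [T] survive in the difference, whence a bound
   proportional to [nrm S * nrm T]. *)
Lemma nrm_mexp_mixed S T :
  nrm (mexp (S + T) - mexp S * mexp T) <=
  2 * ((expR (nrm S) - 1) * (expR (nrm T) - 1)).
Proof.
set s := nrm S; set t := nrm T.
(* The mixed words of [mexp (S + T)] and the product [(mexp S - 1) * (mexp T - 1)] obey the same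
   bound, whence the factor 2. *)
have -> : mexp (S + T) - mexp S * mexp T =
    (mexp (S + T) - mexp S - mexp T + 1) - (mexp S - 1) * (mexp T - 1).
  rewrite mulrBl mulrBr mulr1 mul1r !opprD !opprK !addrA.
  by rewrite [RHS](ACl (1*5*(2*6)*(3*7)*(4*8)))/= !addNr subrr !addr0.
rewrite mulr_natl mulr2n; apply: le_trans (nrmB _ _) _; apply: lerD; last first.
  by apply: le_trans (nrmM _ _) _; rewrite ler_pM ?nrm_ge0 ?nrm_mexpB1.
have -> : (expR s - 1) * (expR t - 1) = expR (s + t) - expR s - expR t + 1.
  by rewrite expRD; ring.
(* The shift by one guarantees a constant term in each partial sum; these cancel and leave positive
   powers only. *)
have cM U := ncvg_shift 1 (mexp_cvg U).
have cR (x : R) : ((fun N => expsumR x (N + 1)) @ \oo --> expR x)%classic.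
  by have := @expsumR_cvg x; rewrite -(cvg_shiftn 1).
have hM := ncvgD (ncvgB (ncvgB (cM (S + T)) (cM S)) (cM T)) (ncvg_cst 1).
have hR := cvgD (cvgB (cvgB (@cR (s + t)) (@cR s)) (@cR t)) (cvg_cst (1 : R)).
apply: (ncvg_nrm_le hM (v := fun N => expsumR (s + t) (N + 1) -
  expsumR s (N + 1) - expsumR t (N + 1) + 1) _ (hR _ _ _ _)) => N.
rewrite /expsum addn1 !(big_ord_recl N)/= !expr0 !fact0 !invr1 !scale1r.
have simp (V : zmodType) (z x y w : V) : z + x - (z + y) - (z + w) + z = x - y - w.
  rewrite !opprD !addrA.
  by rewrite (ACl (2*4*6*(1*3)*(5*7)))/= subrr addNr !addr0.
rewrite simp [leRHS](_ : _ = \sum_(i < N) ((bump 0 i)`!%:R)^-1 *: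
   ((s + t : R^o) ^+ bump 0 i - s ^+ bump 0 i - t ^+ bump 0 i)); last first.
  apply: etrans (simp R 1 _ _ _) _; rewrite -!sumrB; apply: eq_bigr => i _.
  by rewrite !scalerBr.
rewrite -!sumrB; apply: le_trans (nrm_sum _ _ _) _; apply: ler_sum => i _.
rewrite -!scalerBr; apply: nrm_invfactZ; rewrite /bump leq0n add1n.
exact: nrm_exprD_mixed.
Qed.

End Exponential.

(** * Logarithms near the identity *)

Section Logarithm.
Variable n : nat.
Implicit Types L M S T : 'M[K]_n.+1.

(** A pair [(S, N)] stands for the product [mexp S * N]; the first-order logarithm [N - 1] of the
    second factor is moved into the exponent. *)
Definition log_step (p : 'M[K]_n.+1 * 'M[K]_n.+1) :=
  (p.1 + (p.2 - 1), mexp (- (p.2 - 1)) * p.2).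

(** With [M = 1 + L] the new distance is quadratic in [L]; on the ball of radius 1/8 this gives the
    factor 1/2. *)
Lemma log_step_contract S M : nrm (M - 1) <= 8^-1 ->
  nrm ((log_step (S, M)).2 - 1) <= 2^-1 * nrm (M - 1).
Proof.
rewrite /=; set L := M - 1; set x := nrm L => x8.
have x0 : 0 <= x := nrm_ge0 L.
have ME : M = 1 + L by rewrite addrC subrK.
clearbody L; have -> : mexp (- L) * M - 1 = (mexp (- L) - 1 - - L) * (1 + L) - L * L.
  rewrite ME opprK mulrDl (mulrBl (1 + L)) mul1r (mulrDr L) mulr1.
  by rewrite opprD !addrA [RHS](ACl (1*2*(3*4)*(5*6)))/= addNr subrr !addr0.
have nL : nrm (- L) = x by rewrite nrmN.
have x2 : x <= 2^-1 by lra.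
have [_ _ h] := expR_bounds x0 x2.
have h1 : nrm (mexp (- L) - 1 - - L) <= 2 * x ^+ 2.
  by apply: le_trans (nrm_mexpB1B _) _; rewrite nL.
have h2 : nrm (1 + L) <= 1 + x by apply: le_trans (nrmD _ _) _; rewrite nrm1.
apply: (@le_trans _ _ (2 * x ^+ 2 * (1 + x) + x * x)); last by nra.
apply: le_trans (nrmB _ _) _; apply: lerD; last exact: nrmM.
by apply: le_trans (nrmM _ _) _; rewrite ler_pM ?nrm_ge0.
Qed.

Lemma nrm_mexpB1_small T : nrm T <= 2^-1 -> nrm (mexp T - 1) <= 2 * nrm T.
Proof.
move=> h; have [_ h1 _] := expR_bounds (nrm_ge0 T) h.
exact: le_trans (nrm_mexpB1 _) h1.
Qed.

Lemma nrm_mexp_small T : nrm T <= 2^-1 -> nrm (mexp T) <= 2.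
Proof.
move=> h; have [h1 _ _] := expR_bounds (nrm_ge0 T) h.
exact: le_trans (nrm_mexp _) h1.
Qed.

Lemma nrm_mexp_mixed_small S T : nrm S <= 2^-1 -> nrm T <= 2^-1 ->
  nrm (mexp (S + T) - mexp S * mexp T) <= 8 * (nrm S * nrm T).
Proof.
move=> hS hT; have [_ h1 _] := expR_bounds (nrm_ge0 S) hS.
have [_ h2 _] := expR_bounds (nrm_ge0 T) hT.
apply: le_trans (nrm_mexp_mixed _ _) _.
have -> : 8 * (nrm S * nrm T) = 2 * ((2 * nrm S) * (2 * nrm T)) by ring.
by rewrite ler_pM2l// ler_pM// subr_ge0 -[1]expR0 ler_expR nrm_ge0.
Qed.

(* The logarithm is the limit of the iteration [M |-> exp (- (M - 1)) M],
   which squares the distance to the identity and stays inside the commutant. *)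
Lemma mexp_log M : nrm (M - 1) <= 8^-1 ->
  exists2 L, mexp L = M & nrm L <= 2 * nrm (M - 1).
Proof.
set x := nrm (M - 1) => x8; have x0 : 0 <= x := nrm_ge0 _.
pose p k := iter k log_step (0, M).
have small k : nrm ((p k).2 - 1) <= x * 2^-1 ^+ k.
  elim: k => [|k IH]; first by rewrite expr0 mulr1.
  have pk : nrm ((p k).2 - 1) <= 8^-1.
    apply: le_trans IH _; apply: le_trans x8; rewrite ler_piMr//.
    by rewrite exprn_ile1//; lra.
  have := log_step_contract (p k).1 pk; rewrite -surjective_pairing => h.
  rewrite /p iterS; apply: le_trans h _.
  by rewrite exprS mulrCA ler_pM2l.
(* Commutation is part of the invariant because [mexpD] needs it to preserve the product. *)
have inv k : GRing.comm (p k).1 (p k).2 /\ mexp (p k).1 * (p k).2 = M.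
  elim: k => [|k [SM IH]].
    by rewrite mexp0 mul1r; split=> //; exact: commr_sym (commr0 _).
  rewrite /p iterS -/(p k) /log_step /=; set S := (p k).1 in SM IH *.
  set N := (p k).2 in SM IH *.
  have SN : GRing.comm S (N - 1) by apply: commrB => //; exact: commr1.
  have NN : GRing.comm N (N - 1) by apply: commrB => //; exact: commr1.
  split; last first.
    by rewrite mexpD// -mulrA (mulrA (mexp (N - 1))) mexpKN mul1r.
  apply: commrM; last first.
    by apply: commr_sym; apply: commrD; [exact: commr_sym|].
  apply: comm_mexp; apply: commrN; apply: commr_sym; apply: commrD.
    exact: commr_sym.
  by [].
(* Chosen so that [v k.+1 - v k = x * 2^-1 ^+ k], the bound on the k-th increment, with [v 0 = 0]
   and limit [2 * x]. *)
pose v k : R := 2 * x - 2 * (x * 2^-1 ^+ k).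
have gv : ((fun k => x * 2^-1 ^+ k) @ \oo --> (0 : R))%classic.
  have h := cvgM (cvg_cst x) (@cvg_expr R 2^-1 _).
  by move: h; rewrite mulr0; apply; rewrite ger0_norm; lra.
have vl : (v @ \oo --> 2 * x)%classic.
  have h := cvgB (cvg_cst (2 * x : R)) (cvgM (cvg_cst (2 : R)) gv).
  by move: h; rewrite mulr0 subr0; apply.
have step k : nrm ((p k.+1).1 - (p k).1) <= v k.+1 - v k.
  rewrite /p iterS -/(p k) /= (addrC (p k).1) addrK; apply: le_trans (small k) _.
  by rewrite /v exprS le_eqVlt; apply/orP; left; apply/eqP; field.
have [L pL hL] := nrm_complete step vl.
have L2 : nrm L <= 2 * x.
  by have := hL 0; rewrite /= /v expr0 mulr1 subrr !subr0.
exists L => //; symmetry.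
have Llt : nrm L <= 2^-1 by apply: le_trans L2 _; lra.
pose q k := x * 2^-1 ^+ k; have q0 k : 0 <= q k by rewrite mulr_ge0// exprn_ge0.
have qx k : q k <= x by rewrite /q ler_piMr// exprn_ile1//; lra.
apply: ncvg_unique (ncvg_cst M) _.
(* A generous constant for three errors of order [q k]: [N] differs from 1, [mexp T] differs from 1,
   and [mexp (S + T)] differs from [mexp S * mexp T]. *)
apply: (ncvg_squeeze (w := fun k => 80 * q k)); last first.
  by have h := cvgM (cvg_cst (80 : R)) gv; move: h; rewrite mulr0; apply.
move=> k; have [_ <-] := inv k.
set S := (p k).1; set N := (p k).2; pose T := L - S.
have T2 : nrm T <= 2 * q k.
  by apply: le_trans (hL k) _; rewrite /v /q; lra.
have Tlt : nrm T <= 2^-1 by apply: le_trans T2 _; have := qx k; lra.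
have N1 : nrm (N - 1) <= q k := small k.
have LT : L = S + T by rewrite /T addrC subrK.
have S2 : nrm S <= 2^-1.
  have -> : S = L - T by rewrite LT addrK.
  by apply: le_trans (nrmB _ _) _; have := qx k; lra.
have -> : mexp S * N - mexp L = mexp S * (N - 1) - mexp S * (mexp T - 1)
    - (mexp (S + T) - mexp S * mexp T).
  rewrite -LT !mulrBr mulr1 !opprB !addrA.
  by rewrite [RHS](ACl (1*6*(2*3)*(4*5)))/= addNr addNr !addr0.
have e2 := nrm_mexp_small S2.
have a1 : nrm (mexp S * (N - 1)) <= 2 * q k.
  by apply: le_trans (nrmM _ _) _; rewrite ler_pM ?nrm_ge0.
have a2 : nrm (mexp S * (mexp T - 1)) <= 2 * (2 * (2 * q k)).
  apply: le_trans (nrmM _ _) _; rewrite ler_pM ?nrm_ge0//.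
  by apply: le_trans (nrm_mexpB1_small Tlt) _; rewrite ler_pM2l.
have a3 := nrm_mexp_mixed_small S2 Tlt.
apply: le_trans (nrmB _ _) _; have := nrmB (mexp S * (N - 1)) (mexp S * (mexp T - 1)).
have := nrm_ge0 S; have := nrm_ge0 T; have := q0 k; nra.
Qed.

(** The quotient [mexp S * mexp T * mexp (- (S + T))] lies within [16 * (nrm S * nrm T) <= 16^-1] of
    the identity, so [mexp_log] applies. *)
Lemma mexp_merge S T : nrm S <= 16^-1 -> nrm T <= 16^-1 ->
  exists2 L, mexp S * mexp T = mexp L * mexp (S + T) &
    nrm L <= 32 * (nrm S * nrm T).
Proof.
move=> hS hT; have s0 := nrm_ge0 S; have t0 := nrm_ge0 T.
pose M := mexp S * mexp T * mexp (- (S + T)).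
have M1 : nrm (M - 1) <= 16 * (nrm S * nrm T).
  have -> : M - 1 = - (mexp (S + T) - mexp S * mexp T) * mexp (- (S + T)).
    by rewrite opprB mulrBl mexpKN.
  apply: le_trans (nrmM _ _) _; rewrite nrmN.
  have -> : 16 * (nrm S * nrm T) = 8 * (nrm S * nrm T) * 2 by ring.
  rewrite ler_pM ?nrm_ge0//; first by apply: nrm_mexp_mixed_small; lra.
  by apply: nrm_mexp_small; rewrite nrmN; have := nrmD S T; lra.
have [|L eL nL] := @mexp_log M; first by nra.
exists L; first by rewrite eL /M -mulrA mexpNK mulr1.
by lra.
Qed.

End Logarithm.

(** * First-order variation of the operator norm *)

Section RealPart.

Lemma inj_double_inj r s : inj (r *+ 2) = inj (s *+ 2) -> r = s.
Proof. by move/(fmorph_inj inj)/eqP; rewrite eqr_pMn2r// => /eqP. Qed.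

Lemma reD x y : re (x + y) = re x + re y.
Proof.
by apply: inj_double_inj; rewrite mulrnDl (rmorphD _ (re x *+ 2)) -!reE rmorphD/= addrACA.
Qed.

Lemma reZ r x : re (inj r * x) = r * re x.
Proof.
apply: inj_double_inj.
by rewrite -mulrnAr (rmorphM _ r) -!reE rmorphM/= cj_inj mulrDr.
Qed.

Lemma re0 : re 0 = 0.
Proof. by rewrite -(mul0r (0 : K)) -(rmorph0 inj) reZ mul0r. Qed.

Lemma reN x : re (- x) = - re x.
Proof. by apply/eqP; rewrite -addr_eq0 -reD addNr re0. Qed.

Lemma re_inj r : re (inj r) = r.
Proof. by apply: inj_double_inj; rewrite -reE cj_inj rmorphMn mulr2n. Qed.

Lemma re_le x : re x <= absR x.
Proof.
have [h|h] := leP (re x) 0; first by rewrite (le_trans h)// absR_ge0.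
rewrite -(ler_pMn2r (n := 2))// -(absR_inj (mulrn_wge0 2 (ltW h))) -reE mulr2n.
by rewrite -{2}(absR_cj x) absRD.
Qed.

Lemma sqr_absRD x y :
  absR (x + y) ^+ 2 = absR x ^+ 2 + absR y ^+ 2 + re (cj x * y) *+ 2.
Proof.
apply: (fmorph_inj inj).
rewrite (rmorphD _ (_ + _)) (rmorphD _ (absR x ^+ 2)) -!cjM -reE rmorphD rmorphM/= cjK.
by ring.
Qed.

End RealPart.

Section Opnorm2.
Implicit Types (A B H L : 'M[K]_2) (v : 'cV[K]_2).
Local Notation vnorm := (vnorm2 absR).
Local Notation opnorm := (opnorm2 absR).

Lemma vnormE v : vnorm v ^+ 2 = absR (v 0 0) ^+ 2 + absR (v 1 0) ^+ 2.
Proof.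
by rewrite /vnorm2 sum_ord2 sqr_sqrtr// addr_ge0// sqr_ge0.
Qed.

Lemma vnorm_ge0 v : 0 <= vnorm v. Proof. exact: sqrtr_ge0. Qed.

Lemma vnorm_le v c : 0 <= c ->
  absR (v 0 0) ^+ 2 + absR (v 1 0) ^+ 2 <= c ^+ 2 -> vnorm v <= c.
Proof.
by move=> c0 h; rewrite -(@ler_pXn2r _ 2)// ?nnegrE ?vnorm_ge0// vnormE.
Qed.

Lemma mulmx2 B v i : (B *m v) i 0 = B i 0 * v 0 0 + B i 1 * v 1 0.
Proof. by rewrite mxE sum_ord2. Qed.

Lemma vnorm_e0 : vnorm (\col_(i < 2) (i == 0)%:R) = 1.
Proof.
apply/eqP; rewrite -(@eqrXn2 _ 2)// ?vnorm_ge0// vnormE !mxE/= absR1 absR0.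
by rewrite expr1n expr0n addr0.
Qed.

(** Also bounds the set whose supremum is [opnorm2], as [opnorm_ge] requires. *)
Lemma vnorm_mul_le B v : vnorm v = 1 -> vnorm (B *m v) <= 2 * nrm B.
Proof.
move=> v1; have b0 := nrm_ge0 B.
have := vnormE v; rewrite v1 expr1n => /esym v2.
have p := absR_ge0 (v 0 0); have q := absR_ge0 (v 1 0).
have p1 : absR (v 0 0) <= 1 by nra.
have q1 : absR (v 1 0) <= 1 by nra.
have row i : absR ((B *m v) i 0) <= nrm B.
  rewrite mulmx2; apply: le_trans (absRD _ _) _; rewrite !absRM.
  apply: le_trans (row_le_nrm B i); rewrite sum_ord2.
  by rewrite lerD// ler_piMr// absR_ge0.
apply: vnorm_le; first by rewrite mulr_ge0.
have r0 := row 0; have r1 := row 1.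
have s0 := absR_ge0 ((B *m v) 0 0); have s1 := absR_ge0 ((B *m v) 1 0).
by nra.
Qed.

Lemma opnorm_le B c : (forall v, vnorm v = 1 -> vnorm (B *m v) <= c) ->
  opnorm B <= c.
Proof.
move=> h; apply: ge_sup; last by move=> _ [v /= v1 <-]; exact: h.
by exists (vnorm (B *m \col_i (i == 0)%:R)); exists (\col_i (i == 0)%:R) => //=;
  exact: vnorm_e0.
Qed.

Lemma opnorm_ge B v : vnorm v = 1 -> vnorm (B *m v) <= opnorm B.
Proof.
move=> v1; apply: ub_le_sup; last by exists v.
by exists (2 * nrm B) => _ [w /= w1 <-]; exact: vnorm_mul_le.
Qed.

Lemma opnorm_le_nrm B : opnorm B <= 2 * nrm B.
Proof. by apply: opnorm_le => v; exact: vnorm_mul_le. Qed.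

Lemma vnormZ r v : 0 <= r -> vnorm (inj r *: v) = r * vnorm v.
Proof.
move=> r0; apply/eqP; rewrite -(@eqrXn2 _ 2)// ?vnorm_ge0 ?mulr_ge0 ?vnorm_ge0//.
by rewrite exprMn !vnormE !mxE !absRM absR_inj// mulrDr !exprMn.
Qed.

(* Up to the factor [sigma], the derivative at [A] of the operator norm when
   the first basis vector is the unique maximizing direction of [A]. *)
Definition dnorm A H := re (cj (A 0 0) * H 0 0 + cj (A 1 0) * H 1 0).

Lemma dnormD A H L : dnorm A (H + L) = dnorm A H + dnorm A L.
Proof. by rewrite /dnorm -reD !mxE; congr re; ring. Qed.

Lemma dnormN A H : dnorm A (- H) = - dnorm A H.
Proof. by rewrite /dnorm -reN !mxE; congr re; ring. Qed.

Lemma dnormZ A r H : dnorm A (inj r *: H) = r * dnorm A H.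
Proof. by rewrite /dnorm -reZ !mxE; congr re; ring. Qed.

Lemma absR_bilin_le (a b c d : K) p q : absR a <= p -> absR b <= p ->
  absR c <= q -> absR d <= q -> absR (cj a * c + cj b * d) <= 2 * (p * q).
Proof.
move=> ha hb hc hd; apply: le_trans (absRD _ _) _.
rewrite !absRM !absR_cj mulr_natl mulr2n.
by rewrite lerD// ler_pM ?absR_ge0.
Qed.

Lemma dnorm_le A H : dnorm A H <= 2 * (nrm A * nrm H).
Proof.
apply: le_trans (re_le _) _.
by apply: absR_bilin_le; exact: entry_le_nrm.
Qed.

Section Perturbation.
Variables (A : 'M[K]_2) (sigma : R).
Let a := A 0 0.
Let b := A 0 1.
Let c := A 1 0.
Let d := A 1 1.
Hypothesis orth : cj a * b + cj c * d = 0.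
Hypothesis sigma_gt0 : 0 < sigma.
Hypothesis sigmaE : absR a ^+ 2 + absR c ^+ 2 = sigma ^+ 2.
Hypothesis gap : absR b ^+ 2 + absR d ^+ 2 < sigma ^+ 2.

(** Pythagoras: the cross terms are multiples of the inner product of the two columns. *)
Lemma sqr_norm_orth x y :
  absR (a * x + b * y) ^+ 2 + absR (c * x + d * y) ^+ 2 =
  sigma ^+ 2 * absR x ^+ 2 + (absR b ^+ 2 + absR d ^+ 2) * absR y ^+ 2.
Proof.
have orth' : a * cj b + c * cj d = 0.
  by rewrite -(rmorph0 cj) -orth rmorphD !rmorphM/= !cjK.
have [N NE NR] : exists2 N, forall z, absR z ^+ 2 = N z &
    forall z, inj (N z) = cj z * z.
  by exists (fun z => absR z ^+ 2) => // z; rewrite cjM.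
rewrite -sigmaE !NE; apply: (fmorph_inj inj).
rewrite !(rmorphD, rmorphM)/= !NR !(rmorphD, rmorphM)/=.
apply/eqP; rewrite -subr_eq0 [X in X == _](_ : _ =
  cj x * y * (cj a * b + cj c * d) + x * cj y * (a * cj b + c * cj d)).
  by rewrite orth orth' !mulr0 addr0.
by ring.
Qed.

(** On a unit vector [(x, y)] the square of the unperturbed length is
    [sigma ^+ 2 - g * absR y ^+ 2]. The linear change is [2 * dnorm A H] up to terms with a factor
    [absR y]; the gap [g] absorbs these at a cost quadratic in [H]. *)
Lemma opnorm_perturb : exists2 C, 0 <= C & forall r H, 0 <= r ->
  opnorm (inj r *: (A + H)) <= r * (sigma + dnorm A H / sigma + C * nrm H ^+ 2).
Proof.
pose tau := absR b ^+ 2 + absR d ^+ 2; pose g := sigma ^+ 2 - tau.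
have g0 : 0 < g by rewrite subr_gt0.
pose C0 := 64 * nrm A ^+ 2 / g + 8.
have C00 : 0 <= C0 by rewrite addr_ge0// divr_ge0 ?(ltW g0)// mulr_ge0 ?sqr_ge0.
exists (C0 / (2 * sigma)) => [|r H r0].
  by rewrite divr_ge0// mulr_ge0// ltW.
set al := nrm A in C0 C00 *; set h := nrm H.
have al0 : 0 <= al := nrm_ge0 A; have h0 : 0 <= h := nrm_ge0 H.
apply: opnorm_le => v v1; rewrite -scalemxAl vnormZ// ler_wpM2l//.
have := vnormE v; rewrite v1 expr1n => /esym v2.
set x := v 0 0 in v2; set y := v 1 0 in v2.
have x0 := absR_ge0 x; have y0 := absR_ge0 y.
have x1 : absR x <= 1 by nra.
have y1 : absR y <= 1 by nra.
have Eh i j : absR (H i j) <= h := entry_le_nrm H i j.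
have Ea i j : absR (A i j) <= al := entry_le_nrm A i j.
pose u i := A i 0 * x + A i 1 * y; pose k i := H i 0 * x + H i 1 * y.
have kle i : absR (k i) <= 2 * h.
  apply: le_trans (absRD _ _) _; rewrite !absRM.
  by have := Eh i 0; have := Eh i 1; have := absR_ge0 (H i 0);
     have := absR_ge0 (H i 1); nra.
pose f := dnorm A H.
(* The terms of the inner product of [A *m v] and [H *m v] other than [absR x ^+ 2 * f]; each
   contains [y] or its conjugate. *)
pose cross := cj x * y * (cj a * H 0 1 + cj c * H 1 1) +
  (cj y * x * (cj b * H 0 0 + cj d * H 1 0) +
   cj y * y * (cj b * H 0 1 + cj d * H 1 1)).
have crossE : re (cj (u 0) * k 0 + cj (u 1) * k 1) = absR x ^+ 2 * f + re cross.
  rewrite /f /dnorm -reZ -cjM -reD /u /k /cross /a /b /c /d; congr re.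
  by rewrite !rmorphD !rmorphM/=; ring.
have cross_le : re cross <= 6 * (al * h) * absR y.
  apply: le_trans (re_le _) _; apply: le_trans (absRD _ _) _.
  rewrite absRM; apply: le_trans (lerD (lexx _) (absRD _ _)) _.
  rewrite !absRM !absR_cj.
  have e1 := absR_bilin_le (Ea 0 0) (Ea 1 0) (Eh 0 1) (Eh 1 1).
  have e2 := absR_bilin_le (Ea 0 1) (Ea 1 1) (Eh 0 0) (Eh 1 0).
  have e3 := absR_bilin_le (Ea 0 1) (Ea 1 1) (Eh 0 1) (Eh 1 1).
  have step z w (z0 : 0 <= z) (zy : z <= absR y) : 0 <= w -> w <= 2 * (al * h) ->
      z * w <= 2 * (al * h) * absR y.
    by move=> w0 hw; rewrite mulrC ler_pM.
  rewrite (_ : 6 * (al * h) * absR y = 2 * (al * h) * absR y +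
    (2 * (al * h) * absR y + 2 * (al * h) * absR y)); last by ring.
  by apply: lerD; [|apply: lerD]; apply: step => //;
    rewrite ?absR_ge0 ?mulr_ge0 ?ler_piMl ?ler_piMr.
have f_ge : - f <= 2 * (al * h).
  by rewrite -dnormN; apply: le_trans (dnorm_le _ _) _; rewrite nrmN.
have alh : 0 <= al * h by rewrite mulr_ge0.
have zle : vnorm ((A + H) *m v) ^+ 2 <= sigma ^+ 2 + 2 * f + C0 * h ^+ 2.
  rewrite vnormE !mulmx2 !mxE -/x -/y.
  have E i : (A i 0 + H i 0) * x + (A i 1 + H i 1) * y = u i + k i.
    by rewrite /u /k; ring.
  rewrite !E (sqr_absRD (u 0) (k 0)) (sqr_absRD (u 1) (k 1)).
  have := sqr_norm_orth x y; rewrite -/(u 0) -/(u 1) -/tau => uE.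
  (* Replacing [absR x ^+ 2] by 1 costs [- f * absR y ^+ 2]; one factor [absR y <= 1] is dropped to
     match the cross terms. *)
  have yf : absR x ^+ 2 * f <= f + absR y * (2 * (al * h)).
    rewrite (_ : absR x ^+ 2 = 1 - absR y ^+ 2); last by rewrite -v2 addrK.
    have : absR y ^+ 2 * - f <= absR y * (2 * (al * h)).
      apply: (@le_trans _ _ (absR y ^+ 2 * (2 * (al * h)))).
        by rewrite ler_wpM2l// sqr_ge0.
      by rewrite ler_wpM2r ?mulr_ge0// expr2 ler_piMr.
    lra.
  have k0 : absR (k 0) ^+ 2 <= 4 * h ^+ 2.
    by have := kle 0; have := absR_ge0 (k 0); nra.
  have k1 : absR (k 1) ^+ 2 <= 4 * h ^+ 2.
    by have := kle 1; have := absR_ge0 (k 1); nra.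
  (* Completing the square; the 16 is 12 from [2 * re cross] plus 4 from [2 * (absR x ^+ 2 * f)]. *)
  have amgm : 16 * (al * h) * absR y <= g * absR y ^+ 2 + 64 * al ^+ 2 / g * h ^+ 2.
    rewrite -subr_ge0 [leRHS](_ : _ = (g * absR y - 8 * (al * h)) ^+ 2 / g).
      by rewrite divr_ge0 ?sqr_ge0// ltW.
    by field; rewrite gt_eqF.
  have := reD (cj (u 0) * k 0) (cj (u 1) * k 1); rewrite crossE => reE'.
  have uE' : absR (u 0) ^+ 2 + absR (u 1) ^+ 2 = sigma ^+ 2 - g * absR y ^+ 2.
    rewrite uE (_ : absR x ^+ 2 = 1 - absR y ^+ 2); last by rewrite -v2 addrK.
    by rewrite /g; ring.
  by rewrite /C0 [(_ + 8) * _]mulrDl; lra.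
move: (vnorm _) (vnorm_ge0 ((A + H) *m v)) zle => z z0 zle.
(* The square root is removed by [2 * sigma * z <= sigma ^+ 2 + z ^+ 2]. *)
rewrite -(ler_pM2l (x := 2 * sigma)) ?mulr_gt0//.
rewrite [leRHS](_ : _ = sigma ^+ 2 + (sigma ^+ 2 + 2 * f + C0 * h ^+ 2)); last first.
  by rewrite -/f; clearbody f C0 h; field; rewrite gt_eqF.
have := sqr_ge0 (z - sigma); nra.
Qed.

End Perturbation.
End Opnorm2.

(** * Shortening the constant path *)

(** Expanding both exponentials to first order leaves the commutator, the product [- Y * A * Y], and
    terms containing a quadratic remainder [P] or [Q]. *)
Lemma nrm_conjB n (A Y : 'M[K]_n.+1) : nrm Y <= 2^-1 ->
  nrm (mexp Y * A * mexp (- Y) - A - (Y * A - A * Y)) <= 8 * (nrm A * nrm Y ^+ 2).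
Proof.
move=> y2; set y := nrm Y in y2 *; have y0 : 0 <= y := nrm_ge0 Y.
pose P := mexp Y - 1 - Y; pose Q := mexp (- Y) - 1 - - Y.
have [_ _ yb] := expR_bounds y0 y2.
have nP : nrm P <= 2 * y ^+ 2 by apply: le_trans (nrm_mexpB1B _) _.
have nQ : nrm Q <= 2 * y ^+ 2.
  by apply: le_trans (nrm_mexpB1B _) _; rewrite nrmN.
have nN : nrm (mexp (- Y)) <= 2 by apply: nrm_mexp_small; rewrite nrmN.
have n1 : nrm (1 + Y) <= 2.
  by apply: le_trans (nrmD _ _) _; rewrite nrm1 -/y; lra.
have -> : mexp Y * A * mexp (- Y) - A - (Y * A - A * Y) =
    P * A * mexp (- Y) + (1 + Y) * A * Q - Y * A * Y.
  have -> : mexp Y = P + (1 + Y) by rewrite (addrC 1) addrA !subrK.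
  rewrite (mulrDl P) (mulrDl (P * A)) -!addrA; congr (_ + _).
  have -> : mexp (- Y) = Q + (1 - Y) by rewrite (addrC 1) addrA !subrK.
  rewrite (mulrDr _ Q) -addrA; congr (_ + _).
  rewrite mulrBr mulr1 !mulrDl !mul1r !opprD !opprK !addrA.
  by rewrite [LHS](ACl ((1*5)*(2*6)*(3*7)*4))/= !subrr addNr !add0r.
have a0 := nrm_ge0 A.
have h1 : nrm (P * A * mexp (- Y)) <= 2 * y ^+ 2 * nrm A * 2.
  apply: le_trans (nrmM _ _) _; apply: ler_pM => //; rewrite ?nrm_ge0//.
  by apply: le_trans (nrmM _ _) _; apply: ler_pM => //; exact: nrm_ge0.
have h2 : nrm ((1 + Y) * A * Q) <= (1 + y) * nrm A * (2 * y ^+ 2).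
  apply: le_trans (nrmM _ _) _; apply: ler_pM => //; rewrite ?nrm_ge0//.
  apply: le_trans (nrmM _ _) _; apply: ler_pM => //; rewrite ?nrm_ge0//.
  by apply: le_trans (nrmD _ _) _; rewrite nrm1.
have h3 : nrm (Y * A * Y) <= y * nrm A * y.
  apply: le_trans (nrmM _ _) _; apply: ler_pM => //; rewrite ?nrm_ge0//.
  exact: nrmM.
apply: le_trans (nrmB _ _) _; have h4 := nrmD (P * A * mexp (- Y)) ((1 + Y) * A * Q).
have h5 : (1 + y) * nrm A * (2 * y ^+ 2) <= 3 * (nrm A * y ^+ 2).
  rewrite (_ : (1 + y) * nrm A * _ = (2 + 2 * y) * (nrm A * y ^+ 2)); last by ring.
  by rewrite ler_wpM2r ?mulr_ge0 ?sqr_ge0//; lra.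
lra.
Qed.

Section Improvement.
Local Notation opnorm := (opnorm2 absR).

(** An explicit list instead of the infimum, so that it can be conjugated factor by factor. *)
Definition improvable (A : 'M[K]_2) := exists Bs : seq 'M[K]_2,
  [/\ Bs != [::], \prod_(B <- rev Bs) mexp B = mexp A &
      \sum_(B <- Bs) opnorm B < opnorm A].

Lemma mul2E (M N : 'M[K]_2) i j : (M * N) i j = M i 0 * N 0 j + M i 1 * N 1 j.
Proof. by rewrite mxE sum_ord2. Qed.

Lemma matrix2P (M N : 'M[K]_2) : M 0 0 = N 0 0 -> M 0 1 = N 0 1 ->
  M 1 0 = N 1 0 -> M 1 1 = N 1 1 -> M = N.
Proof.
move=> h00 h01 h10 h11; apply/matrixP => i j.
have ord2 (k : 'I_2) : k = 0 \/ k = 1.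
  by case: k => [[|[|//]] ?]; [left|right]; exact: val_inj.
by case: (ord2 i) => ->; case: (ord2 j) => ->.
Qed.

(** Here [y], [y'], [s] stand for [mexp Y], [mexp (- Y)], [mexp S], and [l1], [l2] correct the
    merged factors [ys], [sy]. *)
Lemma prod_conj_telescope (V : pzRingType) (l2 sy l1 ys s y y' b : V) :
  l2 * sy = s * y' -> l1 * ys = y * s -> y' * y = 1 ->
  l2 * (sy * (y * b * y' * (l1 * (ys * 1)))) = s * b * s.
Proof.
move=> h2 h1 h; rewrite mulr1 h1 mulrA h2 !mulrA -(mulrA s) h mulr1.
by rewrite -(mulrA _ y') h mulr1.
Qed.

Lemma improvable_orth (A : 'M[K]_2) (sigma : R) :
  cj (A 0 0) * A 0 1 + cj (A 1 0) * A 1 1 = 0 -> 0 < sigma ->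
  absR (A 0 0) ^+ 2 + absR (A 1 0) ^+ 2 = sigma ^+ 2 ->
  absR (A 0 1) ^+ 2 + absR (A 1 1) ^+ 2 < sigma ^+ 2 ->
  A 1 0 != 0 -> improvable A.
Proof.
move=> orth s0 sE gap c0.
have [C C0 perturb] := opnorm_perturb orth s0 sE gap.
pose X : 'M[K]_2 := delta_mx 0 0.
have X1 : nrm X <= 1.
  apply: nrm_le => // i; rewrite sum_ord2 !mxE/= andbF absR0 addr0.
  by case: (i == 0); rewrite ?absR1 ?absR0.
set al := nrm A; have al0 : 0 <= al := nrm_ge0 A.
pose G := absR (A 1 0) ^+ 2.
have G0 : 0 < G.
  rewrite exprn_gt0// lt_def absR_ge0 andbT; apply: contraNneq c0 => h.
  by apply/eqP; exact: absR_eq0.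
(* The first column of the commutator is [(0, - A 1 0)]. *)
have dX : dnorm A (X * A - A * X) = - G.
  rewrite /dnorm !(mul2E, mxE)/= !(mul1r, mul0r, mulr0, mulr1, addr0, add0r, subrr).
  by rewrite ?add0r mulrN reN cjM re_inj.
(* Coefficient of [e ^+ 3] in the total error: [2 * C] from the outer factors, [128 * al] from [L1]
   and [L2], the rest from the middle factor. *)
pose D := 2 * C + 128 * al + 16 * al ^+ 2 / sigma + 100 * C * al ^+ 2.
have D0 : 0 <= D.
  by rewrite !addr_ge0 ?divr_ge0 ?mulr_ge0 ?mulr_ge0 ?sqr_ge0// ltW.
have [e [e0 e4 eal eD]] : exists e, [/\ 0 < e, e <= 4^-1, e * al <= 16^-1 &
    e * D <= G / (4 * sigma)].
  have sDG : 0 <= 4 * sigma * D / G.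
    by rewrite divr_ge0 ?(ltW G0)// mulr_ge0// mulr_ge0// ltW.
  (* The inverse of a sum of nonnegative terms meets all bounds at once. The first two serve
     [mexp_merge]; the third keeps the error below half of the saving [e ^+ 2 * (G / sigma) / 2]. *)
  pose m := 4 + 16 * al + 4 * sigma * D / G.
  have m0 : 0 < m by rewrite /m; lra.
  have e0 : 0 < m^-1 by rewrite invr_gt0.
  have em : m^-1 * m = 1 by rewrite mulVf// gt_eqF.
  have h1 := mulr_ge0 (ltW e0) sDG; have h2 := mulr_ge0 (ltW e0) al0.
  exists m^-1; move: (m^-1) e0 em h1 h2 => e e0 em h1 h2.
  split=> //; try by move: em; rewrite /m; lra.
  rewrite ler_pdivlMr ?mulr_gt0//.
  have : e * (4 * sigma * D / G) <= 1 by move: em; rewrite /m; lra.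
  rewrite mulrA ler_pdivrMr// mul1r; apply: le_trans.
  by rewrite le_eqVlt; apply/orP; left; apply/eqP; ring.
pose Y := inj (e ^+ 2) *: X; pose S := inj e *: A.
have nY : nrm Y <= e ^+ 2.
  by apply: le_trans (nrmZ_inj _ (sqr_ge0 _)) _; rewrite ler_piMr// sqr_ge0.
have nS : nrm S <= e * al by apply: nrmZ_inj; exact: ltW.
have e2 : e ^+ 2 <= 16^-1 by nra.
have [||L1 P1 nL1] := @mexp_merge _ Y S; [lra|lra|].
have [||L2 P2 nL2] := @mexp_merge _ S (- Y); [lra|rewrite nrmN; lra|].
rewrite nrmN in nL2.
pose M := mexp Y * A * mexp (- Y); pose H := M - A.
have nYS : nrm Y * nrm S <= e ^+ 3 * al.
  apply: (@le_trans _ _ (e ^+ 2 * (e * al))); first by rewrite ler_pM ?nrm_ge0.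
  by rewrite le_eqVlt; apply/orP; left; apply/eqP; ring.
(* The first two exponentials multiply to [mexp Y * mexp S], the last two to [mexp S * mexp (- Y)];
   the middle one is conjugated by [mexp Y]. *)
exists [:: Y + S; L1; inj (1 - 2 * e) *: M; S - Y; L2]; split=> //.
  have cA r s : GRing.comm (inj r *: A) (inj s *: A).
    by rewrite /GRing.comm -!scalerAl -!scalerAr !scalerA mulrC.
  have midE : mexp (inj (1 - 2 * e) *: M) =
      mexp Y * mexp (inj (1 - 2 * e) *: A) * mexp (- Y).
    rewrite -(mexp_conj _ (mexpKN Y) (mexpNK Y)); congr mexp.
    by rewrite /M -[in RHS]scalerAr -[in RHS]scalerAl.
  have -> : mexp A = mexp S * mexp (inj (1 - 2 * e) *: A) * mexp S.
    rewrite -(mexpD (cA _ _)) -[in RHS]scalerDl -rmorphD -(mexpD (cA _ _)).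
    rewrite -[in RHS]scalerDl -rmorphD.
    by rewrite (_ : e + _ + e = 1) ?rmorph1 ?scale1r//; ring.
  rewrite /rev/= 5!big_cons big_nil midE.
  exact: (prod_conj_telescope _ (esym P2) (esym P1) (mexpNK Y)).
rewrite !big_cons big_nil addr0.
have oA : sigma <= opnorm A.
  apply: le_trans (opnorm_ge A vnorm_e0).
  rewrite -(ler_sqr (ltW s0) (vnorm_ge0 _)) vnormE !mulmx2 !mxE/=.
  by rewrite !mulr1 !mulr0 !addr0 sE.
apply: lt_le_trans oA.
(* The first-order changes of the outer norms are [e * phi] and [- (e * phi)], which cancel in the
   sum. *)
pose phi := dnorm A X / sigma.
have nX r : 0 <= r -> nrm (inj r *: X) <= r.
  by move=> r0; apply: le_trans (nrmZ_inj _ r0) _; rewrite ler_piMr.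
have nX2 : nrm (inj e *: X) ^+ 2 <= e ^+ 2.
  by rewrite lerXn2r ?nnegrE ?nrm_ge0 ?nX ?ltW.
have o1 : opnorm (Y + S) <= e * (sigma + e * phi + C * e ^+ 2).
  have -> : Y + S = inj e *: (A + inj e *: X).
    by rewrite scalerDr scalerA -rmorphM -expr2 addrC.
  apply: le_trans (perturb _ _ (ltW e0)) _; rewrite ler_wpM2l ?(ltW e0)//.
  by rewrite dnormZ -mulrA -/phi lerD2l ler_wpM2l.
have o2 : opnorm (S - Y) <= e * (sigma - e * phi + C * e ^+ 2).
  have -> : S - Y = inj e *: (A - inj e *: X).
    by rewrite scalerBr scalerA -rmorphM -expr2.
  apply: le_trans (perturb _ _ (ltW e0)) _; rewrite ler_wpM2l ?(ltW e0)//.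
  by rewrite dnormN dnormZ mulNr -mulrA -/phi nrmN lerD2l ler_wpM2l.
pose Q := H - (Y * A - A * Y).
have nQ : nrm Q <= 8 * (al * e ^+ 4).
  apply: le_trans (nrm_conjB A _) _; first by lra.
  rewrite ler_pM2l// ler_wpM2l// (exprM e 2 2 : e ^+ 4 = _).
  by rewrite lerXn2r ?nnegrE ?nrm_ge0 ?sqr_ge0.
have HE : H = inj (e ^+ 2) *: (X * A - A * X) + Q.
  by rewrite scalerBr scalerAl scalerAr addrC subrK.
have dH : dnorm A H <= - (e ^+ 2 * G) + 16 * al ^+ 2 * e ^+ 4.
  rewrite HE dnormD dnormZ dX mulrN lerD2l; apply: le_trans (dnorm_le _ _) _.
  rewrite (_ : 16 * _ * _ = 2 * (al * (8 * (al * e ^+ 4)))); last by ring.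
  by rewrite ler_pM2l// ler_wpM2l.
have nH : nrm H <= 10 * (al * e ^+ 2).
  rewrite HE scalerBr scalerAl scalerAr -/Y; apply: le_trans (nrmD _ _) _.
  have h1 := nrmB (Y * A) (A * Y); have h2 := nrmM Y A; have h3 := nrmM A Y.
  have h4 : nrm Y * al <= e ^+ 2 * al by rewrite ler_wpM2r.
  have h5 : al * e ^+ 4 <= al * e ^+ 2 * 16^-1.
    have -> : al * e ^+ 4 = al * e ^+ 2 * e ^+ 2 by ring.
    by rewrite ler_wpM2l// mulr_ge0 ?sqr_ge0.
  have h6 : 0 <= al * e ^+ 2 by rewrite mulr_ge0 ?sqr_ge0.
  rewrite -/al in h2 h3; lra.
have nH2 : nrm H ^+ 2 <= 100 * al ^+ 2 * e ^+ 4.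
  rewrite (_ : 100 * _ * _ = (10 * (al * e ^+ 2)) ^+ 2); last by ring.
  by rewrite lerXn2r ?nnegrE ?nrm_ge0// mulr_ge0// mulr_ge0// sqr_ge0.
pose rho := - (e ^+ 2 * G) / sigma + (16 * al ^+ 2 / sigma + 100 * C * al ^+ 2) * e ^+ 4.
have o3 : opnorm (inj (1 - 2 * e) *: M) <= (1 - 2 * e) * (sigma + rho).
  have -> : M = A + H by rewrite addrC subrK.
  apply: le_trans (perturb _ _ _) _; first by lra.
  rewrite ler_wpM2l//; first by lra.
  have -> : sigma + rho = sigma + (- (e ^+ 2 * G) + 16 * al ^+ 2 * e ^+ 4) / sigma
      + C * (100 * al ^+ 2 * e ^+ 4).
    by rewrite /rho; field; rewrite gt_eqF.
  apply: lerD; last by rewrite ler_wpM2l.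
  by rewrite lerD2l ler_wpM2r// invr_ge0 ltW.
have oL1 := opnorm_le_nrm L1; have oL2 := opnorm_le_nrm L2.
rewrite (mulrC (nrm S)) in nL2.
pose g := G / sigma; have g0 : 0 < g by rewrite divr_gt0.
have eD' : e * D <= g / 4.
  by apply: le_trans eD _; rewrite /g invfM mulrA (mulrAC G).
pose k := 16 * al ^+ 2 / sigma + 100 * C * al ^+ 2.
have k0 : 0 <= k by rewrite addr_ge0 ?divr_ge0 ?mulr_ge0 ?sqr_ge0// ltW.
(* Since [e <= 4^-1], the factor [1 - 2 * e] keeps at least half of the saving. *)
have rhoE : (1 - 2 * e) * rho <= - (e ^+ 2 * g) / 2 + k * e ^+ 3.
  have -> : rho = - (e ^+ 2 * g) + k * e ^+ 4.
    by rewrite /rho /g /k; field; rewrite gt_eqF.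
  have h1 : 0 <= e ^+ 2 * g by rewrite mulr_ge0 ?sqr_ge0// ltW.
  have h2 : 0 <= k * e ^+ 3 by rewrite mulr_ge0 ?exprn_ge0// ltW.
  have -> : k * e ^+ 4 = k * e ^+ 3 * e by ring.
  nra.
have e3D : e ^+ 3 * D <= e ^+ 2 * g / 4.
  have -> : e ^+ 3 * D = e ^+ 2 * (e * D) by ring.
  by rewrite -mulrA ler_wpM2l ?sqr_ge0.
have e2g : 0 < e ^+ 2 * g by rewrite mulr_gt0 ?exprn_gt0.
have DE : e ^+ 3 * D = 2 * (C * e ^+ 3) + 128 * (e ^+ 3 * al) + k * e ^+ 3.
  by rewrite /D /k; ring.
have o3' : opnorm (inj (1 - 2 * e) *: M) <=
    sigma - 2 * e * sigma + (- (e ^+ 2 * g) / 2 + k * e ^+ 3).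
  by apply: le_trans o3 _; rewrite mulrDr mulrBl mul1r lerD2l.
have o12 : opnorm (Y + S) + opnorm (S - Y) <= 2 * e * sigma + 2 * (C * e ^+ 3).
  by apply: le_trans (lerD o1 o2) _; rewrite le_eqVlt; apply/orP; left; apply/eqP; ring.
by clear -o12 o3' oL1 oL2 nL1 nL2 nYS e3D e2g DE; lra.
Qed.

End Improvement.

(** * Reduction to orthogonal columns by unitary conjugation *)

Section UnitaryReduction.
Implicit Types (A B M : 'M[K]_2) (v : 'cV[K]_2).
Local Notation vnorm := (vnorm2 absR).
Local Notation opnorm := (opnorm2 absR).

Definition adj M : 'M[K]_2 := (map_mx cj M)^T.

Lemma adjM M N : adj (M * N) = adj N * adj M.
Proof. by rewrite /adj map_mxM trmx_mul. Qed.

Lemma adjK M : adj (adj M) = M.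
Proof. by apply/matrixP => i j; rewrite !mxE cjK. Qed.

(** For a unit vector [(x, y)], the unitary matrix of determinant 1 with this first column; its
    inverse has the same shape. *)
Definition rot (x y : K) : 'M[K]_2 :=
  \matrix_(i < 2, j < 2) if i == 0 then (if j == 0 then x else - cj y)
                         else (if j == 0 then y else cj x).

Lemma adj_rot x y : adj (rot x y) = rot (cj x) (- y).
Proof. by apply: matrix2P; rewrite !mxE/= ?rmorphN ?cjK ?opprK. Qed.

Lemma rotK x y : absR x ^+ 2 + absR y ^+ 2 = 1 ->
  rot x y * rot (cj x) (- y) = 1.
Proof.
move=> /(congr1 inj); rewrite rmorphD -!cjM rmorph1 => xy.
by apply: matrix2P; rewrite !(mul2E, mxE)/= ?cjK ?rmorphN/= -?xy; ring.
Qed.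

Lemma rotKV x y : absR x ^+ 2 + absR y ^+ 2 = 1 ->
  rot (cj x) (- y) * rot x y = 1.
Proof. by move=> xy; apply: mulmx1C; exact: rotK. Qed.

Lemma unit_rotV x y : absR x ^+ 2 + absR y ^+ 2 = 1 ->
  absR (cj x) ^+ 2 + absR (- y) ^+ 2 = 1.
Proof. by rewrite absR_cj absRN. Qed.

Lemma vnorm_rot x y v : absR x ^+ 2 + absR y ^+ 2 = 1 ->
  vnorm (rot x y *m v) = vnorm v.
Proof.
move=> xy; apply/eqP; rewrite -(@eqrXn2 _ 2)// ?vnorm_ge0// !vnormE !mulmx2 !mxE/=.
have /(congr1 inj) := xy; rewrite rmorphD -!cjM rmorph1 => xy1.
apply/eqP; apply: (fmorph_inj inj).
rewrite (rmorphD _ (_ ^+ 2)) (rmorphD _ (absR (v 0 0) ^+ 2)) -!cjM.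
rewrite -[RHS]mul1r -xy1 !rmorphD !rmorphM/= !rmorphN/= !cjK.
ring.
Qed.

Lemma opnorm_rot_le x y B : absR x ^+ 2 + absR y ^+ 2 = 1 ->
  opnorm (rot x y * B * rot (cj x) (- y)) <= opnorm B.
Proof.
move=> xy; apply: opnorm_le => v v1; rewrite -!mulmxA vnorm_rot//.
by apply: opnorm_ge; rewrite vnorm_rot//; exact: unit_rotV.
Qed.

(** Conjugating each factor conjugates the product of exponentials and preserves operator norms. *)
Lemma improvable_rot x y A : absR x ^+ 2 + absR y ^+ 2 = 1 ->
  improvable (rot (cj x) (- y) * A * rot x y) -> improvable A.
Proof.
move=> xy [Bs [Bs0 prodE sumE]].
pose cj' B := rot x y * B * rot (cj x) (- y).
have cA : A = cj' (rot (cj x) (- y) * A * rot x y).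
  by rewrite /cj' !mulrA rotK// mul1r -mulrA rotK// mulr1.
exists (map cj' Bs); split.
- by case: Bs Bs0 {prodE sumE}.
- rewrite -map_rev big_map [in RHS]cA mexp_conj ?rotK ?rotKV// -prodE.
  elim: (rev Bs) => [|B s IH]; first by rewrite !big_nil mulr1 rotK.
  rewrite !big_cons IH mexp_conj ?rotK ?rotKV//.
  by rewrite !mulrA -(mulrA _ (rot (cj x) (- y)) (rot x y)) rotKV// mulr1.
- rewrite big_map; apply: (@le_lt_trans _ _ (\sum_(B <- Bs) opnorm B)).
    by apply: ler_sum => B _; exact: opnorm_rot_le.
  apply: lt_le_trans sumE _.
  by have := opnorm_rot_le A (unit_rotV xy); rewrite cjK opprK.
Qed.

Definition gram A := adj A * A.

Lemma gramE A i j : gram A i j = cj (A 0 i) * A 0 j + cj (A 1 i) * A 1 j.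
Proof. by rewrite mul2E !mxE. Qed.

Lemma gram_diag A j : gram A j j = inj (absR (A 0 j) ^+ 2 + absR (A 1 j) ^+ 2).
Proof. by rewrite gramE !cjM -rmorphD. Qed.

(* The explicit unit eigenvector [(q, t)] of the Hermitian matrix
   [[p, q], [cj q, r]] for its largest eigenvalue [p + t], where
   [t (t + p - r) = |q|^2]. *)
Lemma diagonalize_hermitian (p r : R) (q : K) : exists x y,
  [/\ absR x ^+ 2 + absR y ^+ 2 = 1,
      (inj r - inj p) * (cj x * cj y) + q * cj x ^+ 2 - cj q * cj y ^+ 2 = 0 &
      0 <= (p - r) * (absR x ^+ 2 - absR y ^+ 2) + re (cj x * q * y) *+ 4].
Proof.
have [->|q0] := eqVneq q 0.
  have [rp|pr] := leP r p.
    exists 1, 0; rewrite absR1 absR0 !(rmorph0, rmorph1) !mulr0 mul0r.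
    rewrite re0 mul0rn expr1n !expr0n/= !(mulr0, mul0r, addr0, subr0, mulr1).
    by split=> //; rewrite subr_ge0.
  exists 0, 1; rewrite absR1 absR0 !(rmorph0, rmorph1) !mulr0 mul0r.
  rewrite re0 mul0rn expr1n !expr0n/=.
  rewrite !(mulr0, mul0r, addr0, add0r, subr0, sub0r, mulrN1, oppr0).
  by rewrite opprB subr_ge0 ltW.
pose n2 := absR q ^+ 2.
have n20 : 0 < n2.
  rewrite exprn_gt0// lt_def absR_ge0 andbT; apply: contraNneq q0 => h.
  by apply/eqP; exact: absR_eq0.
pose w := Num.sqrt ((p - r) ^+ 2 + 4 * n2).
have wE : w ^+ 2 = (p - r) ^+ 2 + 4 * n2.
  by rewrite sqr_sqrtr// addr_ge0 ?sqr_ge0// mulr_ge0// ltW.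
have w0 : 0 <= w := sqrtr_ge0 _.
(* The positive root of the quadratic equation, with discriminant [w ^+ 2]; [s] below normalizes
   [(q, t)]. *)
pose t := (w - (p - r)) / 2.
have tE : t * (t + (p - r)) = n2.
  have -> : t * (t + (p - r)) = (w ^+ 2 - (p - r) ^+ 2) / 4 by rewrite /t; field.
  by rewrite wE; field.
have t0 : 0 < t.
  have : p - r < w by have := sqr_ge0 (p - r); nra.
  by rewrite /t; lra.
pose s := Num.sqrt (n2 + t ^+ 2).
have s2 : s ^+ 2 = n2 + t ^+ 2 by rewrite sqr_sqrtr// addr_ge0 ?sqr_ge0// ltW.
have s0 : 0 < s by rewrite sqrtr_gt0 addr_gt0// exprn_gt0.
have sV : 0 <= s^-1 by rewrite invr_ge0 ltW.
clearbody s; clearbody t.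
exists (inj s^-1 * q), (inj (s^-1 * t)).
have n2E : absR (inj s^-1 * q) ^+ 2 = s^-1 ^+ 2 * n2.
  by rewrite absRM absR_inj// exprMn.
have t2E : absR (inj (s^-1 * t)) ^+ 2 = s^-1 ^+ 2 * t ^+ 2.
  by rewrite absR_inj ?exprMn// mulr_ge0// ltW.
split; rewrite ?n2E ?t2E.
- by rewrite -mulrDr -s2 -exprMn mulVf ?expr1n// gt_eqF.
- rewrite !rmorphM/= !cj_inj.
  have := congr1 inj tE; rewrite /n2 -cjM rmorphM !rmorphD/= rmorphN => tE'.
  rewrite [LHS](_ : _ = inj s^-1 ^+ 2 * cj q *
    (cj q * q - inj t * (inj t + (inj p - inj r)))); first by rewrite tE' subrr mulr0.
  by ring.
- have -> : re (cj (inj s^-1 * q) * q * inj (s^-1 * t)) = s^-1 ^+ 2 * (t * n2).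
    rewrite -[RHS]re_inj; congr re.
    rewrite (rmorphM _ (s^-1 ^+ 2)) (rmorphM _ t n2) /n2 -cjM (rmorphXn _ 2).
    by rewrite (rmorphM _ (inj s^-1) q) (rmorphM _ s^-1 t) cj_inj; ring.
  rewrite [X in 0 <= X](_ : _ =
    s^-1 ^+ 2 * ((p - r) * (n2 - t ^+ 2) + 4 * (t * n2))); last by ring.
  rewrite mulr_ge0 ?sqr_ge0// -tE.
  have := mulr_ge0 (ltW t0) (sqr_ge0 (p - r)).
  have : 0 <= t * n2 by rewrite mulr_ge0 ?ltW.
  by rewrite -tE; lra.
Qed.

(** The Gram matrix is conjugated along with [A]. The second clause of [diagonalize_hermitian] is
    the vanishing of its off-diagonal entry, the third the order of its diagonal. *)
Lemma exists_orth_rot A : exists x y, absR x ^+ 2 + absR y ^+ 2 = 1 /\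
  let A' := rot (cj x) (- y) * A * rot x y in
  cj (A' 0 0) * A' 0 1 + cj (A' 1 0) * A' 1 1 = 0 /\
  absR (A' 0 1) ^+ 2 + absR (A' 1 1) ^+ 2 <=
  absR (A' 0 0) ^+ 2 + absR (A' 1 0) ^+ 2.
Proof.
have [g [p [r [q [gE q01 q10 g00 g11]]]]] : exists g p r q, [/\ gram A = g,
    g 0 1 = q, g 1 0 = cj q, g 0 0 = inj p & g 1 1 = inj r].
  exists (gram A); do 3!eexists; split; rewrite ?gram_diag//.
  by rewrite !gramE rmorphD !rmorphM/= !cjK; ring.
have [x [y [xy orth le]]] := diagonalize_hermitian p r q.
exists x, y; split=> //=; set A' := _ * rot x y.
have gA' : gram A' = rot (cj x) (- y) * g * rot x y.
  rewrite -gE /gram /A' !adjM -[rot (cj x) (- y)]adj_rot adjK adj_rot -!mulrA.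
  by congr (_ * (_ * _)); rewrite mulrA rotK// mul1r.
split.
  rewrite -gramE gA' !mul2E q10 q01 g00 g11 !mxE/=.
  by rewrite rmorphN/= -{}orth; ring.
rewrite -ler_inj -!gram_diag gA' !mul2E q10 q01 g00 g11.
rewrite !mxE/= ?rmorphN/= ?cjK -subr_ge0.
rewrite [X in 0 <= X](_ : _ =
  inj ((p - r) * (absR x ^+ 2 - absR y ^+ 2) + re (cj x * q * y) *+ 4)).
  exact: inj_ge0.
rewrite (mulrnA _ 2 2) (rmorphD _ ((p - r) * _)) (rmorphM _ (p - r)).
rewrite (rmorphMn _ 2) -reE (rmorphB _ p) (rmorphB _ (absR x ^+ 2)) -!cjM.
by rewrite !rmorphM/= ?cjK; ring.
Qed.

(** After the reduction the remaining hypotheses of [improvable_orth] can fail only for a normal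
    matrix: columns of equal length give a multiple of a unitary matrix, and [A' 1 0 = 0] gives a
    diagonal one. *)
Lemma improvable_nonnormal A : A * adj A <> adj A * A -> improvable A.
Proof.
move=> nnA; have [x [y [xy [orth le]]]] := exists_orth_rot A.
apply: (improvable_rot xy); set A' := _ * rot x y in orth le *.
have AE : A = rot x y * A' * rot (cj x) (- y).
  by rewrite /A' !mulrA rotK// mul1r -mulrA rotK// mulr1.
clearbody A'; have {nnA} nnA' : A' * adj A' <> adj A' * A'.
  move=> h; apply: nnA.
  have adE : adj A = rot x y * adj A' * rot (cj x) (- y).
    by rewrite AE !adjM !adj_rot cjK opprK !mulrA.
  have sandwich M N : rot x y * M * rot (cj x) (- y) *
      (rot x y * N * rot (cj x) (- y)) = rot x y * (M * N) * rot (cj x) (- y).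
    by rewrite !mulrA -(mulrA _ (rot (cj x) (- y)) (rot x y)) rotKV// mulr1.
  by rewrite adE AE !sandwich h.
pose S := absR (A' 0 0) ^+ 2 + absR (A' 1 0) ^+ 2.
have S0 : 0 <= S by rewrite addr_ge0 ?sqr_ge0.
have orth' : cj (A' 0 1) * A' 0 0 + cj (A' 1 1) * A' 1 0 = 0.
  by rewrite -(rmorph0 cj) -orth rmorphD !rmorphM/= !cjK; ring.
have gap : absR (A' 0 1) ^+ 2 + absR (A' 1 1) ^+ 2 < S.
  rewrite lt_neqAle le andbT; apply/eqP => eqS; apply: nnA'.
  have gA : adj A' * A' = (inj S)%:M.
    change (gram A' = (inj S)%:M).
    by apply: matrix2P; rewrite ?gram_diag ?gramE ?orth ?orth' ?eqS !mxE.
  have [S00|S1] := eqVneq S 0.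
    have sq0 z w : absR z ^+ 2 + absR w ^+ 2 = S -> z = 0 /\ w = 0.
      rewrite S00 => /eqP; rewrite paddr_eq0 ?sqr_ge0// !sqrf_eq0.
      by case/andP => /eqP/absR_eq0 -> /eqP/absR_eq0 ->.
    have [z00 z10] := sq0 _ _ (erefl S); have [z01 z11] := sq0 _ _ eqS.
    have -> : A' = 0 by apply: matrix2P; rewrite mxE.
    by rewrite mul0r mulr0.
  (* A left inverse of a square matrix is a right inverse, so [A'] commutes with its adjoint. *)
  have h : (inj S^-1 *: adj A') * A' = 1.
    by rewrite -scalerAl gA scale_scalar_mx -rmorphM mulVf// rmorph1.
  have {}h : A' * (inj S^-1 *: adj A') = 1 by apply: mulmx1C.
  rewrite gA -[LHS]scale1r -(rmorph1 inj) -(mulfV S1) rmorphM -scalerA scalerAr h.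
  by rewrite scalemx1.
have S1 : 0 < S by apply: le_lt_trans gap; rewrite addr_ge0 ?sqr_ge0.
apply: (@improvable_orth _ (Num.sqrt S)); rewrite ?sqrtr_gt0 ?sqr_sqrtr//.
apply/eqP => c0; apply: nnA'.
have a0 : A' 0 0 != 0.
  by apply: contraTneq S1 => a0; rewrite /S a0 c0 absR0 expr0n addr0 ltxx.
have b0 : A' 0 1 = 0.
  move: orth; rewrite c0 rmorph0 mul0r addr0 => /eqP.
  by rewrite mulf_eq0 fmorph_eq0 (negbTE a0) => /eqP.
by apply: matrix2P; rewrite !mul2E !mxE b0 c0 !rmorph0
  ?(mulr0, mul0r, addr0, add0r)// mulrC.
Qed.

Lemma magnus_lt A : A * adj A <> adj A * A ->
  (magnus absR (mexp A) < (opnorm A)%:E)%E.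
Proof.
move=> /improvable_nonnormal[Bs [Bs0 prodE sumE]].
apply: (@le_lt_trans _ _ (\sum_(B <- Bs) opnorm B)%:E); last by rewrite lte_fin.
by apply: ereal_inf_lbound; exists Bs.
Qed.

End UnitaryReduction.

End Generic.

(** * Real and complex scalars *)

(** The sequence [u + v] is nondecreasing and bounded above, hence converges, and [u] is its
    difference with [v]. *)
Lemma cvgn_dominated_steps (R : realType) (u v : nat -> R) :
  (forall n, `|u n.+1 - u n| <= v n.+1 - v n) -> cvgn v ->
  exists l, ((fun n => `|u n - l|) @ \oo --> (0 : R))%classic.
Proof.
move=> h cv.
have vn : nondecreasing_seq v.
  by apply/nondecreasing_seqP => n; rewrite -subr_ge0; apply: le_trans (h n).
have wn : nondecreasing_seq (u + v).
  apply/nondecreasing_seqP => n; rewrite /= -subr_ge0.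
  have := h n; rewrite ler_norml => /andP[h1 _].
  rewrite [X in 0 <= X](_ : _ = (u n.+1 - u n) + (v n.+1 - v n)); first by lra.
  by rewrite !fctE; ring.
have ule n : u n <= u 0%N + (v n - v 0%N).
  elim: n => [|n IH]; first by rewrite subrr addr0.
  by have := h n; rewrite ler_norml => /andP[_ h1]; lra.
have cw : cvgn (u + v).
  apply: nondecreasing_is_cvgn => //.
  exists (u 0%N + (limn v - v 0%N) + limn v) => _ [n _ <-].
  have := nondecreasing_cvgn_le vn cv n; have := ule n.
  by rewrite fctE; lra.
have cu : cvgn u.
  have -> : u = (u + v) - v by rewrite addrK.
  exact: is_cvgB.
exists (limn u).
have := cvg_norm (cvgB cu (cvg_cst (limn u))).
by rewrite subrr normr0; apply.
Qed.

(** Transparent, so that [cj] reduces to the identity and [adj] to the transpose in the final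
    theorem. *)
Definition real_scalars (R : realType) : scalar_field (@absRe R).
Proof.
apply: (@ScalarField R R (@absRe R) idfun idfun id) => //.
- by move=> e e0; exists e.
- by move=> x; rewrite /absRe real_normK ?num_real// expr2.
- exact: cvgn_dominated_steps.
Defined.

Lemma absCx_ge_Re (R : realType) (z : R[i]) : `|complex.Re z| <= absCx z.
Proof.
by rewrite -sqrtr_sqr ler_sqrt ?lerDl ?addr_ge0 ?sqr_ge0.
Qed.

Lemma absCx_ge_Im (R : realType) (z : R[i]) : `|complex.Im z| <= absCx z.
Proof.
by rewrite -sqrtr_sqr ler_sqrt ?lerDr ?addr_ge0 ?sqr_ge0.
Qed.

Lemma absCx_le (R : realType) (z : R[i]) :
  absCx z <= `|complex.Re z| + `|complex.Im z|.
Proof.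
rewrite -[leRHS]ger0_norm ?addr_ge0// -sqrtr_sqr ler_sqrt ?sqr_ge0//.
rewrite sqrrD !real_normK ?num_real// addrAC lerDl.
by rewrite mulrn_wge0// mulr_ge0.
Qed.

Definition complex_scalars (R : realType) : scalar_field (@absCx R).
Proof.
apply: (@ScalarField R R[i] (@absCx R) (real_complex R) (@conjc R) (@complex.Re R)).
- by case=> a b; rewrite normc_def.
- by move=> r; rewrite lecR.
- by case=> a b; rewrite ltcE/= => /andP[/eqP -> a0]; exists a.
- case=> a b; rewrite /absCx sqr_sqrtr ?addr_ge0 ?sqr_ge0//=.
  by apply/eqP; rewrite eq_complex/=; apply/andP; split; apply/eqP; ring.
- exact: conjcK.
- by move=> r; rewrite /= oppr0.
- by case=> a b; apply/eqP; rewrite eq_complex/= subrr mulr2n !eqxx.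
- move=> u v h cv.
  have stepRe n : `|complex.Re (u n.+1) - complex.Re (u n)| <= v n.+1 - v n.
    by move: (le_trans (absCx_ge_Re _) (h n)); case: (u n.+1); case: (u n).
  have stepIm n : `|complex.Im (u n.+1) - complex.Im (u n)| <= v n.+1 - v n.
    by move: (le_trans (absCx_ge_Im _) (h n)); case: (u n.+1); case: (u n).
  have [a ha] := cvgn_dominated_steps stepRe cv.
  have [b hb] := cvgn_dominated_steps stepIm cv.
  exists (a +i* b)%C.
  have hab := cvgD ha hb; rewrite addr0 in hab.
  apply: (squeeze_cvgr _ (cvg_cst (0 : R)) (hab _)); apply: nearW => n.
  rewrite {1}/absCx sqrtr_ge0 fctE /=.
  by move: (absCx_le (u n - (a +i* b)%C)); case: (u n).
Defined.

Theorem theorem5p1 (R : realType) :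
  (forall A : 'M[R]_2, ~ normal_real A ->
     (magnus (@absRe R) (mexp A) < (opnorm2 (@absRe R) A)%:E)%E) /\
  (forall A : 'M[R[i]]_2, ~ normal_cx A ->
     (magnus (@absCx R) (mexp A) < (opnorm2 (@absCx R) A)%:E)%E).
Proof.
split=> A nA.
  apply: (magnus_lt (F := real_scalars R)); rewrite /adj.
  by have -> : map_mx (cj (real_scalars R)) A = A by apply/matrixP => i j; rewrite mxE.
exact: (magnus_lt (F := complex_scalars R)).
Qed.
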